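(* Let $\mathcal H$ be a real Hilbert space, let $F_1,\dots,F_N:\mathcal H\to\mathcal H$ and $F:=\frac1N\sum_{i=1}^N F_i$. Assume: (i) $\mathcal G$ is a strongly connected directed graph on $\{1,\dots,N\}$, and $A=(a_{ij})$, $B=(b_{ij})$ are a row-stochastic and a column-stochastic $N\times N$ matrix consistent with $\mathcal G$ with $a_{ii}>0$, $b_{ii}>0$ for all $i$ (see context); (ii) for each $i$ there is $L_i>0$ with $\|F_i(x)-F_i(y)\|\le L_i\|x-y\|$ for all $x,y\in\mathcal H$; (iii) $F$ is quasi-nonexpansive with $Fix(F)\ne\emptyset$, and there is a constant $\kappa>0$ such that $d_{Fix(F)}(x)\le \kappa\|F(x)-x\|$ for all $x\in\mathcal H$. Let $\delta\in(0,1)$ be any pre-specified parameter and suppose the stepsize $\alpha$ satisfies $$0<\alpha<\min\{1-\delta,\alpha_c\},$$ where $\alpha_c$ is the smallest positive real root of the equation $\det(I-M(\alpha))=0$, with $$M(\alpha):=\begin{pmatrix}(1-\alpha)\rho_1 & \alpha c_2\theta_1 & 0\\ \theta_2(\alpha\theta_3+\theta_4) & \rho_2+\alpha\theta_1\theta_2 & 2\alpha c_1\theta_2\\ \frac{\alpha\bar L}{c_1} & \frac{\alpha\sqrt N\,\theta_1}{c_1} & 1-\frac{\delta\alpha}{4\kappa^2}\end{pmatrix},$$ $\bar L:=\max_i L_i$, $\theta_1:=\frac{c_4\|D_\nu^{-1}\|}{N}$, $\theta_2:=\frac{c_2\bar L(\sqrt N+1)}{c_1c_3}$, $\theta_3:=\rho_1+\bar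 L$, $\theta_4:=\|A-I\|$ (the quantities $\rho_1,\rho_2,c_1,\dots,c_4,D_\nu$ are defined in the context). Then all the sequences $(x_{i,k})_{k\ge0}$, $i=1,\dots,N$, generated by the DOT algorithm (see context), for arbitrary initial points $x_{i,0}\in\mathcal H$, converge to a common point in $Fix(F)$ at a linear rate.
   Context: Operators: $Fix(T)=\{x: T(x)=x\}$. $T$ is quasi-nonexpansive if $\|T(x)-y\|\le\|x-y\|$ for all $x\in\mathcal H$, $y\in Fix(T)$. $d_X(z)=\inf_{x\in X}\|z-x\|$. Graph and matrices: $\mathcal G=(\{1,\dots,N\},\mathcal E)$ is a simple directed graph, an edge $(i,j)\in\mathcal E$ meaning that $i$ can send information to $j$; strongly connected means any node can be reached from any other by a directed path. $A,B$ are nonnegative; consistency with $\mathcal G$ means that for $i\ne j$, $a_{ij}>0$ iff $(j,i)\in\mathcal E$, and $b_{ij}>0$ iff $(j,i)\in\mathcal E$. Let $\pi=(\pi_1,\dots,\pi_N)^\top$ and $\nu=(\nu_1,\dots,\nu_N)^\top$ be the stochastic (entries summing to $1$) vectors with $\pi^\top A=\pi^\top$ and $B\nu=\nu$; then $\pi_i,\nu_i>0$, $A_\infty:=\lim_k A^k=\mathbf 1_N\pi^\top$, $B_\infty:=\lim_k B^k=\nu\mathbf 1_N^\top$. $D_\nu:=\mathrm{diag}(\nu_1,\dots,\nu_N)$. DOT algorithm: choose arbitrary $x_{i,0}\in\mathcal H$, put $y_{i,0}=F_i(x_{i,0})$, and for $k\ge0$ and each $i$ $$x_{i,k+1}=\sum_{j=1}^N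 a_{ij}x_{j,k}+\alpha\Big(\frac{y_{i,k}}{N\nu_i}-\sum_{j=1}^N a_{ij}x_{j,k}\Big),\qquad y_{i,k+1}=\sum_{j=1}^N b_{ij}y_{j,k}+F_i(x_{i,k+1})-F_i(x_{i,k}).$$ Norms: for $z=(z_1,\dots,z_N)$ in $\mathcal H^N$ (or in $\mathbb R^N$, with absolute values), $\|z\|=\sqrt{\sum_i\|z_i\|^2}$, $\|z\|_\pi=\sqrt{\sum_i\pi_i\|z_i\|^2}$, $\|z\|_\nu=\sqrt{\sum_i\|z_i\|^2/\nu_i}$. For $N\times N$ real matrices, $\|\cdot\|,\|\cdot\|_\pi,\|\cdot\|_\nu$ denote the norms induced by the corresponding norms on $\mathbb R^N$. $\rho_1:=\|A-A_\infty\|_\pi$ and $\rho_2:=\|B-B_\infty\|_\nu$ (both are known to be $<1$). $c_1,c_2,c_3,c_4>0$ are constants such that $c_1\|\cdot\|\le\|\cdot\|_\pi\le c_2\|\cdot\|$ and $c_3\|\cdot\|_\nu\le\|\cdot\|_\pi\le c_4\|\cdot\|_\nu$ hold for these vector norms (on $\mathcal H^N$ and $\mathbb R^N$) and for the induced matrix norms. Convergence of all $x_{i,k}$ to a common point at a linear rate means: there are $x^*\in Fix(F)$, $C>0$ and $r\in(0,1)$ with $\|x_{i,k}-x^*\|\le Cr^k$ for all $i$ and all $k\ge0$. *)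

(* Defs.v *)
From HB Require Import structures.
From mathcomp Require Import all_boot all_order all_algebra.
From mathcomp Require Import sesquilinear.
From mathcomp Require Import all_classical all_reals all_analysis.

Set Implicit Arguments.
Unset Strict Implicit.
Unset Printing Implicit Defensive.

Import Order.TTheory GRing.Theory Num.Theory.
Import numFieldNormedType.Exports.

Local Open Scope classical_set_scope.
Local Open Scope ring_scope.

Section Operators.
Context {R : realType} {H : normedModType R}.

(* A real Hilbert space is a complete normed module H whose norm satisfies
   this identity for some positive definite symmetric bilinear form on H. *)
Definition norm_of_dot (ip : {dot H for idfun}) : Prop :=
  forall x : H, `|x| ^+ 2 = ip x x.

Definition Fix (T : H -> H) : set H := [set x | T x = x].

Definition quasi_nonexpansive (T : H -> H) : Prop :=
  forall x y, Fix T y -> `|T x - y| <= `|x - y|.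

Definition dist_to (X : set H) (z : H) : R := inf [set `|z - x| | x in X].

Definition average (N : nat) (Fs : 'I_N -> H -> H) (x : H) : H :=
  N%:R^-1 *: \sum_(i < N) Fs i x.

End Operators.

Section GraphMatrices.
Context {R : realType} {N : nat}.

(* [e i j] means that i can send information to j. *)
Definition simple_digraph (e : rel 'I_N) : Prop := irreflexive e.

Definition strongly_connected (e : rel 'I_N) : Prop :=
  forall i j, connect e i j.

(* The entry (i, j) weights what i receives from j, whence [e j i]. *)
Definition consistent (e : rel 'I_N) (A : 'M[R]_N) : Prop :=
  forall i j, i != j -> (0 < A i j) = e j i.

Definition nonneg_mx (A : 'M[R]_N) : Prop := forall i j, 0 <= A i j.

Definition row_stochastic (A : 'M[R]_N) : Prop :=
  nonneg_mx A /\ forall i, \sum_(j < N) A i j = 1.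

Definition col_stochastic (A : 'M[R]_N) : Prop :=
  nonneg_mx A /\ forall j, \sum_(i < N) A i j = 1.

Definition sums_to_one (v : 'cV[R]_N) : Prop := \sum_(i < N) v i ord0 = 1.

Definition mx_infty (A : 'M[R]_N) : 'M[R]_N := lim (A ^+ k @[k --> \oo]).

End GraphMatrices.

Section Norms.
Context {R : realType} {N : nat}.

Definition w_one : 'I_N -> R := fun=> 1.
Definition w_pi (p : 'cV[R]_N) : 'I_N -> R := fun i => p i ord0.
Definition w_nu (v : 'cV[R]_N) : 'I_N -> R := fun i => (v i ord0)^-1.

(* Used with V = H for the norms on H^N and with V = R for those on R^N. *)
Definition wnorm {V : normedZmodType R} (w : 'I_N -> R) (z : 'I_N -> V) : R :=
  Num.sqrt (\sum_(i < N) w i * `|z i| ^+ 2).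

Definition cvnorm (w : 'I_N -> R) (u : 'cV[R]_N) : R :=
  wnorm w (fun i => u i ord0).

(* Operator norm induced by [cvnorm w]; the library norm `|A| of a matrix is
   the maximum of the absolute values of the entries. *)
Definition opnorm (w : 'I_N -> R) (A : 'M[R]_N) : R :=
  sup [set cvnorm w (A *m u) | u in [set u | cvnorm w u <= 1]].

Definition norm_constants (H : normedModType R) (p v : 'cV[R]_N)
    (c1 c2 c3 c4 : R) : Prop :=
  let compare (n1 np nv : R) :=
    (c1 * n1 <= np <= c2 * n1) /\ (c3 * nv <= np <= c4 * nv) in
  [/\ forall z : 'I_N -> H,
        compare (wnorm w_one z) (wnorm (w_pi p) z) (wnorm (w_nu v) z),
      forall u : 'cV[R]_N,
        compare (cvnorm w_one u) (cvnorm (w_pi p) u) (cvnorm (w_nu v) u)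
    & forall A : 'M[R]_N,
        compare (opnorm w_one A) (opnorm (w_pi p) A) (opnorm (w_nu v) A)].

End Norms.

Section Algorithm.
Context {R : realType} {H : normedModType R} {N : nat}.

Definition DOT_sequence (A B : 'M[R]_N) (v : 'cV[R]_N) (Fs : 'I_N -> H -> H)
    (a : R) (x y : nat -> 'I_N -> H) : Prop :=
  [/\ forall i, y 0%N i = Fs i (x 0%N i),
      forall k i,
        let m := \sum_(j < N) A i j *: x k j in
        x k.+1 i = m + a *: ((N%:R * v i ord0)^-1 *: y k i - m)
    & forall k i,
        y k.+1 i = \sum_(j < N) B i j *: y k j
                   + Fs i (x k.+1 i) - Fs i (x k i)].

Definition linear_common_convergence (X : set H) (x : nat -> 'I_N -> H) : Prop :=
  exists xs : H, X xs /\
  exists C r : R, [/\ 0 < C, 0 < r < 1 &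
    forall i k, `|x k i - xs| <= C * r ^+ k].

End Algorithm.

Section Stepsize.
Context {R : realType} {N : nat}.

Definition Mstep (A B : 'M[R]_N) (p v : 'cV[R]_N) (c1 c2 c3 c4 : R)
    (L : 'I_N -> R) (kappa delta a : R) : 'M[R]_3 :=
  let rho1 := opnorm (w_pi p) (A - mx_infty A) in
  let rho2 := opnorm (w_nu v) (B - mx_infty B) in
  let Lbar := \big[Num.max/0]_(i < N) L i in
  let sqN := Num.sqrt (N%:R : R) in
  let theta1 := c4 * opnorm w_one (invmx (diag_mx v^T)) / N%:R in
  let theta2 := c2 * Lbar * (sqN + 1) / (c1 * c3) in
  let theta3 := rho1 + Lbar in
  let theta4 := opnorm w_one (A - 1%:M) in
  let rows :=
    [:: [:: (1 - a) * rho1; a * c2 * theta1; 0];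
        [:: theta2 * (a * theta3 + theta4); rho2 + a * theta1 * theta2;
            2 * a * c1 * theta2];
        [:: a * Lbar / c1; a * sqN * theta1 / c1;
            1 - delta * a / (4 * kappa ^+ 2)]] in
  \matrix_(i < 3, j < 3) nth 0 (nth [::] rows i) j.

Definition smallest_positive_root (f : R -> R) (a : R) : Prop :=
  [/\ 0 < a, f a = 0 & forall b, 0 < b -> f b = 0 -> a <= b].

End Stepsize.

(* Main.v *)
(** With xb(k) = sum_i p_i x_i(k) and yb(k) = sum_i y_i(k), the three errors
    |x(k) - 1 xb(k)|_p, |y(k) - v yb(k)|_v and d_{Fix F}(xb(k)) satisfy
    e(k+1) <= M(alpha) e(k) entrywise: the first two because A - A_oo and
    B - B_oo contract, the third because averaged quasi-nonexpansive maps
    decrease the distance to Fix F under the error bound.  Since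
    det (I - M(a)) = a g(a) with g(0) > 0, the determinant is positive on
    (0, alpha_c), so adj (I - M(alpha)) 1 is a positive vector w with
    M(alpha) w < w, and all errors decay geometrically.  Hence xb(k) is Cauchy
    and its limit is a fixed point of F.

    That the matrices contract (rho_1, rho_2 < 1) comes from an explicit
    variance estimate; the operator norms, defined on R^N, carry over to H^N
    because positive semidefinite forms stay nonnegative on vectors of H. *)

Require Import Defs.
From HB Require Import structures.
From mathcomp Require Import all_boot all_order all_algebra.
From mathcomp Require Import sesquilinear ring lra.
From mathcomp Require Import all_classical all_reals all_analysis.

Set Implicit Arguments.
Unset Strict Implicit.
Unset Printing Implicit Defensive.

Import Order.TTheory GRing.Theory Num.Theory.
Import numFieldNormedType.Exports.

Local Open Scope classical_set_scope.
Local Open Scope ring_scope.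

(** * Weighted norms and their operator norms *)

(** At stepsize 0 the last row of M is (0, 0, 1), since without a step nothing moves towards Fix F;
    this is the factor a of the determinant. Dividing it out leaves g(0) = (1 - rho_1)(1 - rho_2)
    delta / (4 kappa^2), so strict contraction of both mixing matrices is what fixes the initial
    sign, and a sign change of g before alpha_c would produce an earlier root.

    The weights pi and 1/nu are forced by the contraction: in the Euclidean norm A - A_oo may well
    expand. The price is a factor c_1, ..., c_4 at each passage between norms.

    No projection onto Fix F is constructed. The distance is an infimum, so estimates are proved
    against an arbitrary fixed point and then passed to the infimum. The sign of 1 - delta alpha /
    (4 kappa^2) is not given either; only its product with the distance is known to be nonnegative.

    Decay of the distance to a set does not by itself give a limit point. The residual |F xb - xb|
    is at most twice that distance, which makes the increments of xb summable. *)

Section WeightedNorms.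
Context {R : realType} {N : nat}.
Implicit Types (w : 'I_N -> R) (V : normedZmodType R).

Lemma weighted_Cauchy_Schwarz w (a b : 'I_N -> R) : (forall i, 0 <= w i) ->
  (\sum_i w i * (a i * b i)) ^+ 2 <=
    (\sum_i w i * a i ^+ 2) * (\sum_i w i * b i ^+ 2).
Proof.
move=> w0.
have sumM (f g : 'I_N -> R) :
    (\sum_i f i) * (\sum_i g i) = \sum_i \sum_j f i * g j.
  by rewrite big_distrl; apply: eq_bigr => i _; rewrite big_distrr.
(* Lagrange's identity *)
have : 0 <= \sum_i \sum_j w i * w j * (a i * b j - a j * b i) ^+ 2.
  apply: sumr_ge0 => i _; apply: sumr_ge0 => j _.
  by rewrite mulr_ge0 ?sqr_ge0 ?mulr_ge0.
set S := (X in 0 <= X).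
suff -> : S = 2 * ((\sum_i w i * a i ^+ 2) * (\sum_i w i * b i ^+ 2)
  - (\sum_i w i * (a i * b i)) ^+ 2) by move=> ?; lra.
have -> : S = \sum_i \sum_j (w i * a i ^+ 2) * (w j * b j ^+ 2)
   + \sum_i \sum_j (w i * b i ^+ 2) * (w j * a j ^+ 2)
   - 2 * \sum_i \sum_j (w i * (a i * b i)) * (w j * (a j * b j)).
  rewrite mulr_sumr -big_split -sumrB; apply: eq_bigr => i _ /=.
  rewrite mulr_sumr -big_split -sumrB; apply: eq_bigr => j _ /=; ring.
rewrite -!sumM; ring.
Qed.

Lemma wnorm_ge0 V w (z : 'I_N -> V) : 0 <= wnorm w z.
Proof. exact: sqrtr_ge0. Qed.

Lemma wnorm_sqr V w (z : 'I_N -> V) : (forall i, 0 <= w i) ->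
  wnorm w z ^+ 2 = \sum_i w i * `|z i| ^+ 2.
Proof.
by move=> w0; rewrite sqr_sqrtr// sumr_ge0// => i _; rewrite mulr_ge0// sqr_ge0.
Qed.

Lemma wnorm_dominated (V V' : normedZmodType R) w (z : 'I_N -> V)
    (z' : 'I_N -> V') c : (forall i, 0 <= w i) -> 0 <= c ->
  (forall i, `|z i| <= c * `|z' i|) -> wnorm w z <= c * wnorm w z'.
Proof.
move=> w0 c0 zz'.
rewrite -(ler_pXn2r (ltn0Sn 1)) ?nnegrE ?mulr_ge0 ?wnorm_ge0//.
rewrite exprMn !wnorm_sqr// mulr_sumr ler_sum// => i _.
rewrite [leRHS]mulrCA ler_wpM2l// -exprMn ler_pXn2r ?nnegrE ?mulr_ge0//.
Qed.

Lemma wnorm_le (V V' : normedZmodType R) w (z : 'I_N -> V) (z' : 'I_N -> V') :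
  (forall i, 0 <= w i) -> (forall i, `|z i| <= `|z' i|) ->
  wnorm w z <= wnorm w z'.
Proof.
move=> w0 zz'; rewrite -[leRHS]mul1r; apply: wnorm_dominated => // i.
by rewrite mul1r.
Qed.

Lemma wnormD V w (z z' : 'I_N -> V) : (forall i, 0 <= w i) ->
  wnorm w (fun i => z i + z' i) <= wnorm w z + wnorm w z'.
Proof.
move=> w0; rewrite -(ler_pXn2r (ltn0Sn 1)) ?nnegrE ?addr_ge0 ?wnorm_ge0//.
rewrite sqrrD !wnorm_sqr//.
have CS : \sum_i w i * (`|z i| * `|z' i|) <= wnorm w z * wnorm w z'.
  rewrite -(ler_pXn2r (ltn0Sn 1)) ?nnegrE ?mulr_ge0 ?wnorm_ge0//; last first.
    by apply: sumr_ge0 => i _; rewrite !mulr_ge0.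
  by rewrite exprMn !wnorm_sqr// weighted_Cauchy_Schwarz.
apply: le_trans (_ : _ <= \sum_i w i * `|z i| ^+ 2 +
   (\sum_i w i * (`|z i| * `|z' i|)) *+ 2 
   + \sum_i w i * `|z' i| ^+ 2) _; last first.
  by rewrite lerD2r lerD2l lerMn2r CS orbT.
rewrite -mulr_natl mulr_sumr -!big_split ler_sum// => i _ /=.
have : `|z i + z' i| ^+ 2 <= (`|z i| + `|z' i|) ^+ 2.
  by rewrite ler_pXn2r ?nnegrE ?addr_ge0// ler_normD.
move/(ler_wpM2l (w0 i)); nra.
Qed.

Lemma wnormB V w (z z' : 'I_N -> V) : (forall i, 0 <= w i) ->
  wnorm w (fun i => z i - z' i) <= wnorm w z + wnorm w z'.
Proof.
move=> w0; apply: le_trans (wnormD _ _ w0) _; rewrite lerD2l.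
by apply: wnorm_le => // i; rewrite normrN.
Qed.

Lemma norm_coord_le_wnorm V w (z : 'I_N -> V) i : (forall i, 0 < w i) ->
  `|z i| <= (Num.sqrt (w i))^-1 * wnorm w z.
Proof.
move=> w0; rewrite mulrC ler_pdivlMr ?sqrtr_gt0//.
rewrite -(ler_pXn2r (ltn0Sn 1)) ?nnegrE ?mulr_ge0 ?sqrtr_ge0//.
have w0' j := ltW (w0 j).
rewrite wnorm_sqr// exprMn sqr_sqrtr// mulrC (bigD1 i)//= lerDl.
by apply: sumr_ge0 => j _; rewrite mulr_ge0// sqr_ge0.
Qed.

End WeightedNorms.

Section OperatorNorm.
Context {R : realType} {N : nat}.
Implicit Types (w : 'I_N -> R) (G : 'M[R]_N).

(** A crude bound, wanted only for the finiteness of the supremum in [opnorm]: on an unbounded set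
    [sup] is a default value. *)
Lemma opnorm_bound_exists w G : (forall i, 0 < w i) ->
  exists2 C, 0 <= C & forall u, cvnorm w (G *m u) <= C * cvnorm w u.
Proof.
move=> w0; have w0' i := ltW (w0 i).
pose K (i : 'I_N) : R := \sum_j `|G i j| * (Num.sqrt (w j))^-1.
exists (wnorm w K) => [|u]; first exact: wnorm_ge0.
rewrite mulrC; apply: wnorm_dominated => //; first exact: wnorm_ge0.
move=> i; rewrite mxE; apply: le_trans (ler_norm_sum _ _ _) _.
apply: le_trans (_ : _ <= cvnorm w u * K i) _; last first.
  by rewrite ler_wpM2l ?wnorm_ge0// ler_norm.
rewrite mulr_sumr ler_sum// => j _; rewrite normrM mulrCA ler_wpM2l//.
by rewrite mulrC; exact: (norm_coord_le_wnorm (fun i => u i ord0)).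
Qed.

Lemma opnorm_has_sup w G : (forall i, 0 < w i) ->
  has_sup [set cvnorm w (G *m u) | u in [set u | cvnorm w u <= 1]].
Proof.
move=> w0; split.
  exists (cvnorm w (G *m 0)), 0 => //=.
  rewrite /cvnorm /wnorm big1 ?sqrtr0// => i _.
  by rewrite mxE normr0 expr0n mulr0.
have [C C0 hC] := opnorm_bound_exists G w0.
by exists C => _ [u /= u1 <-]; rewrite (le_trans (hC u))// ler_piMr.
Qed.

Lemma cvnormZ w c u : (forall i, 0 <= w i) ->
  cvnorm w (c *: u) = `|c| * cvnorm w u.
Proof.
move=> w0; apply/le_anti; rewrite wnorm_dominated//=; last first.
  by move=> i; rewrite mxE normrM.
have [->|c0] := eqVneq c 0; first by rewrite normr0 mul0r wnorm_ge0.
rewrite mulrC -ler_pdivlMr ?normr_gt0// mulrC.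
apply: wnorm_dominated => //= i.
by rewrite mxE normrM mulKf// normr_eq0.
Qed.

Lemma opnorm_ub w G u : (forall i, 0 < w i) ->
  cvnorm w (G *m u) <= opnorm w G * cvnorm w u.
Proof.
move=> w0; have w0' i := ltW (w0 i).
(* A vector of norm zero cannot be normalized; the crude bound already shows that its image has norm
   zero. *)
have [u0|u0] := eqVneq (cvnorm w u) 0.
  by have [C _ /(_ u)] := opnorm_bound_exists G w0; rewrite u0 !mulr0.
have u_gt0 : 0 < cvnorm w u by rewrite lt_neqAle eq_sym u0 wnorm_ge0.
rewrite -ler_pdivrMr// mulrC.
have cV : `|(cvnorm w u)^-1| = (cvnorm w u)^-1.
  by rewrite ger0_norm// invr_ge0 wnorm_ge0.
apply: ub_le_sup; first by case: (opnorm_has_sup G w0).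
exists ((cvnorm w u)^-1 *: u) => /=; first by rewrite cvnormZ// cV mulVf.
by rewrite -scalemxAr cvnormZ// cV.
Qed.

Lemma opnorm_le w G c : (forall i, 0 < w i) -> 0 <= c ->
  (forall u, cvnorm w (G *m u) <= c * cvnorm w u) -> opnorm w G <= c.
Proof.
move=> w0 c0 hc; apply: ge_sup; first by case: (opnorm_has_sup G w0).
by move=> _ [u /= u1 <-]; rewrite (le_trans (hc u))// ler_piMr.
Qed.

Lemma opnorm_ge0 w G : (forall i, 0 < w i) -> 0 <= opnorm w G.
Proof.
move=> w0; apply: le_trans (_ : 0 <= cvnorm w (G *m 0)) _.
  exact: wnorm_ge0.
apply: ub_le_sup; first by case: (opnorm_has_sup G w0).
exists 0 => //=; rewrite /cvnorm /wnorm big1 ?sqrtr0// => i _.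
by rewrite mxE normr0 expr0n mulr0.
Qed.

Lemma opnorm1 w : (0 < N)%N -> (forall i, 0 < w i) -> opnorm w 1%:M = 1.
Proof.
move=> hN w0; have w0' i := ltW (w0 i).
apply/le_anti; rewrite opnorm_le//=; last by move=> u; rewrite mul1mx mul1r.
pose u : 'cV[R]_N := const_mx 1.
have u0 : 0 < cvnorm w u.
  rewrite sqrtr_gt0 (bigD1 (Ordinal hN))//= ltr_pwDl//.
    by rewrite mxE normr1 expr1n mulr1.
  by apply: sumr_ge0 => i _; rewrite mulr_ge0// sqr_ge0.
by have := opnorm_ub 1%:M u w0; rewrite mul1mx ler_pMl.
Qed.

End OperatorNorm.

(** * Positive semidefinite forms on vectors of a module *)

Section PositiveForms.
Context {R : realType} {N : nat}.

Definition quad (S : 'I_N -> 'I_N -> R) (u : 'I_N -> R) : R :=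
  \sum_i \sum_j S i j * (u i * u j).

Lemma quad_shift S u k t : (forall i j, S i j = S j i) ->
  quad S (fun i => u i + t * (i == k)%:R) =
  quad S u + 2 * t * (\sum_j S k j * u j) + t ^+ 2 * S k k.
Proof.
move=> S_sym.
have sum_delta (f : 'I_N -> R) : \sum_j f j * (j == k)%:R = f k.
  rewrite (bigD1 k)//= eqxx mulr1 big1 ?addr0// => i /negPf ->.
  by rewrite mulr0.
have -> : quad S (fun i => u i + t * (i == k)%:R) =
    quad S u + \sum_i \sum_j (S i j * u i * t) * (j == k)%:R
    + \sum_i (\sum_j S i j * u j * t + t ^+ 2 * S i k) * (i == k)%:R.
  rewrite /quad -!big_split; apply: eq_bigr => i _ /=.
  have -> : t ^+ 2 * S i k = \sum_j t ^+ 2 * S i j * (j == k)%:R.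
    by rewrite (sum_delta (fun j => t ^+ 2 * S i j)).
  rewrite mulrDl !mulr_suml -!big_split; apply: eq_bigr => j _ /=; ring.
rewrite (sum_delta (fun i => \sum_j S i j * u j * t + t ^+ 2 * S i k)).
under eq_bigr => i _.
  rewrite (sum_delta (fun j => S i j * u i * t)) S_sym; over.
rewrite -!mulr_suml; ring.
Qed.

Definition psd (S : 'I_N -> 'I_N -> R) : Prop :=
  (forall i j, S i j = S j i) /\ (forall u, 0 <= quad S u).

Lemma quad_delta S k : quad S (fun i => (i == k)%:R) = S k k.
Proof.
rewrite /quad (bigD1 k)//= (bigD1 k)//= eqxx !mulr1 !big1 ?addr0// => i /negPf ik.
  by rewrite big1// => j _; rewrite ik mul0r mulr0.
by rewrite ik !mulr0.
Qed.

Lemma psd_diag_ge0 S k : psd S -> 0 <= S k k.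
Proof. by move=> [_ S0]; rewrite -quad_delta. Qed.

(** Along the [k]-th axis the form is affine in [t] with slope [2 * S k l], so a nonzero slope would
    make it negative; the chosen [t] gives the value -1. *)
Lemma psd_null_row S k l : psd S -> S k k = 0 -> S k l = 0.
Proof.
move=> [S_sym S0] Skk.
have sum_delta : \sum_j S k j * (j == l)%:R = S k l.
  rewrite (bigD1 l)//= eqxx mulr1 big1 ?addr0// => i /negPf ->.
  by rewrite mulr0.
have key t : 0 <= S l l + 2 * t * S k l.
  have := S0 (fun i => (i == l)%:R + t * (i == k)%:R).
  by rewrite quad_shift// quad_delta sum_delta Skk mulr0 addr0.
apply/eqP; apply: contraT => Skl.
have := key (- (S l l + 1) / (2 * S k l)).
suff -> : S l l + 2 * (- (S l l + 1) / (2 * S k l)) * S k l = -1 by lra.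
by field; rewrite Skl.
Qed.

(** This is the Schur complement. Its value at [u] is the minimum of [quad S] over all changes of
    the [k]-th coordinate of [u], attained at the shift [- s / S k k]. *)
Lemma psd_eliminate S k : psd S -> S k k != 0 ->
  psd (fun i j => S i j - S k i * S k j / S k k).
Proof.
move=> [S_sym S0] Skk; split=> [i j|u]; first by rewrite S_sym; ring.
pose s := \sum_j S k j * u j.
have -> : quad (fun i j => S i j - S k i * S k j / S k k) u =
    quad S u - s ^+ 2 / S k k.
  have -> : s ^+ 2 / S k k =
      \sum_i \sum_j S k i * S k j / S k k * (u i * u j).
    rewrite expr2 /s mulr_suml mulr_suml; apply: eq_bigr => i _.
    rewrite mulr_sumr mulr_suml; apply: eq_bigr => j _; ring.
  rewrite /quad -sumrB; apply: eq_bigr => i _.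
  rewrite -sumrB; apply: eq_bigr => j _; ring.
have := S0 (fun i => u i + (- s / S k k) * (i == k)%:R).
rewrite quad_shift// -/s.
suff -> : quad S u + 2 * (- s / S k k) * s + (- s / S k k) ^+ 2 * S k k =
  quad S u - s ^+ 2 / S k k by [].
by field.
Qed.

Context {V : lmodType R} (b : V -> V -> R).
Context (bC : forall x y, b x y = b y x).
Context (bDl : forall x y z, b (x + y) z = b x z + b y z).
Context (bZl : forall c x y, b (c *: x) y = c * b x y).
Context (b_ge0 : forall x, 0 <= b x x).

Lemma form_sum2 (f g : 'I_N -> R) (z : 'I_N -> V) :
  b (\sum_i f i *: z i) (\sum_j g j *: z j) =
  \sum_i \sum_j f i * g j * b (z i) (z j).
Proof.
have b0 x : b 0 x = 0 by rewrite -(scale0r 0) bZl mul0r.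
have suml F x : b (\sum_(i < N) F i) x = \sum_i b (F i) x.
  by apply: (big_morph (b^~ x)) => [y y'|]; rewrite ?bDl ?b0.
rewrite suml; apply: eq_bigr => i _.
rewrite bZl bC suml mulr_sumr; apply: eq_bigr => j _.
by rewrite bZl bC mulrA.
Qed.

(* Completing squares reduces the number of nonzero diagonal entries of S. *)
Lemma psd_form_ge0 S (z : 'I_N -> V) : psd S ->
  0 <= \sum_i \sum_j S i j * b (z i) (z j).
Proof.
have [n] := ubnP #|[pred i | S i i != 0]|; elim: n S => // n IH S Sn S_psd.
have [k Skk|S0] := pickP (fun k => S k k != 0); last first.
  rewrite big1// => i _; rewrite big1// => j _.
  by rewrite psd_null_row ?mul0r//; apply/eqP/negPn; rewrite S0.
pose S' i j := S i j - S k i * S k j / S k k.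
have S'_psd : psd S' by exact: psd_eliminate.
have -> : \sum_i \sum_j S i j * b (z i) (z j) =
    \sum_i \sum_j S' i j * b (z i) (z j) +
    (S k k)^-1 * b (\sum_j S k j *: z j) (\sum_j S k j *: z j).
  rewrite form_sum2 mulr_sumr -big_split; apply: eq_bigr => i _ /=.
  rewrite mulr_sumr -big_split; apply: eq_bigr => j _ /=.
  rewrite /S'; ring.
rewrite addr_ge0//; last by rewrite mulr_ge0// invr_ge0 psd_diag_ge0.
apply: IH => //; rewrite -ltnS; apply: leq_trans Sn.
(* A zero diagonal entry of [S] has a zero row, hence stays zero in [S'], while the entry at [k]
   becomes zero. *)
rewrite ltnS; apply: proper_card; apply/properP; split.
  apply/fintype.subsetP => i; rewrite !inE; apply: contraNN => /eqP Sii.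
  rewrite /S' Sii (_ : S k i = 0) ?mul0r ?subr0//.
  by case: (S_psd) => -> _; exact: psd_null_row.
exists k; rewrite !inE ?Skk// negbK /S'.
by rewrite mulfK// subrr.
Qed.

(** With [W] the diagonal matrix of [w], the matrix [S = opnorm w G ^+ 2 W - G^T W G] is positive
    semidefinite because of the scalar bound [opnorm_ub]. Evaluating it on vectors of [V] avoids
    coordinates, which matters as [V] may have infinite dimension. *)
Lemma opnorm_form w (G : 'M[R]_N) (z : 'I_N -> V) : (forall i, 0 < w i) ->
  \sum_i w i * b (\sum_j G i j *: z j) (\sum_j G i j *: z j) <=
  opnorm w G ^+ 2 * \sum_i w i * b (z i) (z i).
Proof.
move=> w0; have w0' i := ltW (w0 i).
pose S i j := opnorm w G ^+ 2 * w i * (j == i)%:R - \sum_l w l * (G l i * G l j).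
have SE (c : 'I_N -> 'I_N -> R) : \sum_i \sum_j S i j * c i j =
    opnorm w G ^+ 2 * (\sum_i w i * c i i)
    - \sum_l w l * \sum_i \sum_j G l i * G l j * c i j.
  have -> : \sum_l w l * \sum_i \sum_j G l i * G l j * c i j =
      \sum_i \sum_j (\sum_l w l * (G l i * G l j)) * c i j.
    under eq_bigr do rewrite mulr_sumr.
    rewrite exchange_big; apply: eq_bigr => i _ /=.
    under eq_bigr do rewrite mulr_sumr.
    rewrite exchange_big; apply: eq_bigr => j _ /=.
    by rewrite mulr_suml; apply: eq_bigr => l _; rewrite !mulrA.
  rewrite mulr_sumr -sumrB; apply: eq_bigr => i _.
  have -> : opnorm w G ^+ 2 * (w i * c i i) =
      \sum_j opnorm w G ^+ 2 * w i * (j == i)%:R * c i j.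
    rewrite (bigD1 i)//= eqxx mulr1 mulrA big1 ?addr0// => j /negPf ->.
    by rewrite mulr0 mul0r.
  by rewrite -sumrB; apply: eq_bigr => j _; rewrite mulrBl.
suff : 0 <= \sum_i \sum_j S i j * b (z i) (z j).
  rewrite SE subr_ge0; under eq_bigr do rewrite -form_sum2; exact.
apply: psd_form_ge0; split=> [i j|u].
  rewrite /S; congr (_ - _); last first.
    by apply: eq_bigr => l _; rewrite [G l i * _]mulrC.
  by have [->|ij] := eqVneq i j; rewrite ?mulr0.
rewrite /quad SE subr_ge0.
have : cvnorm w (G *m \col_i u i) ^+ 2 <=
    (opnorm w G * cvnorm w (\col_i u i)) ^+ 2.
  by rewrite ler_pXn2r ?nnegrE ?mulr_ge0 ?opnorm_ge0 ?wnorm_ge0 ?opnorm_ub.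
rewrite exprMn /cvnorm !wnorm_sqr//.
under [in leRHS]eq_bigr do rewrite real_normK ?num_real// mxE expr2.
apply: le_trans; apply: ler_sum => i _; rewrite ler_wpM2l//.
rewrite real_normK ?num_real// mxE expr2 mulr_suml ler_sum// => j _.
rewrite mulr_sumr ler_sum// => l _.
by rewrite !mxE mulrACA.
Qed.

Lemma weighted_variance_form w (z : 'I_N -> V) : \sum_i w i = 1 ->
  let m := \sum_i w i *: z i in
  \sum_i w i * b (z i - m) (z i - m) = \sum_i w i * b (z i) (z i) - b m m.
Proof.
move=> w1 m.
have bDr x y t : b x (y + t) = b x y + b x t by rewrite bC bDl !(bC x).
have bNl x y : b (- x) y = - b x y by rewrite -scaleN1r bZl mulN1r.
have bNr x y : b x (- y) = - b x y by rewrite bC bNl bC.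
have bm x : b m x = \sum_i w i * b (z i) x.
  have b0 : b 0 x = 0 by rewrite -(scale0r 0) bZl mul0r.
  rewrite (big_morph (b^~ x) (id1 := 0) (op1 := +%R))//.
  by apply: eq_bigr => i _; rewrite bZl.
transitivity (\sum_i w i * b (z i) (z i) - 2 * (\sum_i w i * b (z i) m)
   + (\sum_i w i) * b m m).
  rewrite mulr_sumr -sumrB mulr_suml -big_split; apply: eq_bigr => i _ /=.
  rewrite !(bDl, bDr, bNl, bNr) (bC m (z i)); ring.
rewrite -bm w1; ring.
Qed.

End PositiveForms.

(** * Stochastic matrices *)

Section StochasticMatrices.
Context {R : realType} {N : nat}.

Lemma connect_invariant (T : finType) (e : rel T) (P : T -> Prop) x y :
  (forall a b, e a b -> P a -> P b) -> connect e x y -> P x -> P y.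
Proof.
move=> eP /connectP[s + ->]; elim: s x => //= z s IH x /andP[xz zs] Px.
exact: IH zs (eP _ _ xz Px).
Qed.

Definition irreducible_mx (A : 'M[R]_N) : Prop :=
  forall i j, connect [rel i j | 0 < A i j] i j.

(** Positivity spreads along edges: stationarity gives [q b >= q a * A a b]. *)
Lemma nonneg_stationary_pos (A : 'M[R]_N) (q : 'I_N -> R) i j :
  nonneg_mx A -> irreducible_mx A -> (forall i, 0 <= q i) ->
  (forall j, \sum_i q i * A i j = q j) -> 0 < q i -> 0 < q j.
Proof.
move=> A0 Airr q0 qA.
apply: (connect_invariant (P := fun k => 0 < q k) _ (Airr i j)) => a b /= Aab qa.
rewrite -qA (bigD1 a)//= ltr_pwDl ?mulr_gt0// sumr_ge0// => k _.
by rewrite mulr_ge0.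
Qed.

(** The signs of [p] are unknown at first. The triangle inequality gives |p| <= |p| A entrywise;
    both sides have the same total because rows sum to 1, so |p| is stationary as well. *)
Lemma stationary_pos (A : 'M[R]_N) (p : 'cV[R]_N) :
  row_stochastic A -> irreducible_mx A -> sums_to_one p -> p^T *m A = p^T ->
  forall i, 0 < p i ord0.
Proof.
move=> [A0 A1] Airr p1 pA.
have pE j : \sum_i p i ord0 * A i j = p j ord0.
  move/matrixP: pA => /(_ ord0 j); rewrite !mxE => <-.
  by apply: eq_bigr => i _; rewrite mxE.
have le_abs j : `|p j ord0| <= \sum_i `|p i ord0| * A i j.
  rewrite -{1}pE (le_trans (ler_norm_sum _ _ _))// ler_sum// => i _.
  by rewrite normrM (ger0_norm (A0 i j)).
have absE j : \sum_i `|p i ord0| * A i j = `|p j ord0|.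
  apply/eqP; rewrite -subr_eq0; apply/eqP.
  apply: (psumr_eq0P (P := predT)
    (F := fun j => \sum_i `|p i ord0| * A i j - `|p j ord0|)) => //.
    by move=> k _; rewrite subr_ge0.
  rewrite sumrB exchange_big /=; apply/eqP; rewrite subr_eq0; apply/eqP.
  by apply: eq_bigr => i _; rewrite -mulr_sumr A1 mulr1.
(* A nonnegative stationary vector, positive exactly where [p] is negative. One negative entry of
   [p] would make all of them negative, against the sum 1. *)
pose q i := `|p i ord0| - p i ord0.
have q0 i : 0 <= q i by rewrite subr_ge0 ler_norm.
have qA j : \sum_i q i * A i j = q j.
  rewrite /q -[in RHS](absE j) -[X in _ = _ - X](pE j) -sumrB.
  by apply: eq_bigr => i _; rewrite mulrBl.
have p0 i : 0 <= p i ord0.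
  rewrite leNgt; apply/negP => pi.
  have qi : 0 < q i by rewrite subr_gt0 (lt_le_trans pi).
  suff : \sum_i p i ord0 <= 0 by rewrite p1 ler10.
  apply: sumr_le0 => j _; have := nonneg_stationary_pos j A0 Airr q0 qA qi.
  by rewrite /q subr_gt0; case: ler0P => // pj; rewrite ltxx.
move=> j; have [i pi|p_eq0] := pickP (fun i => 0 < p i ord0).
  exact: (nonneg_stationary_pos _ A0 Airr p0 pE pi).
have : \sum_i p i ord0 <= 0 by apply: sumr_le0 => i _; rewrite leNgt p_eq0.
by rewrite p1 ler10.
Qed.

Lemma variance_pairs (w u : 'I_N -> R) : \sum_i w i = 1 ->
  \sum_j \sum_l w j * w l * (u j - u l) ^+ 2 =
  2 * (\sum_j w j * u j ^+ 2 - (\sum_j w j * u j) ^+ 2).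
Proof.
move=> w1; transitivity (\sum_j (w j * u j ^+ 2 * (\sum_l w l)
    - 2 * (w j * u j) * (\sum_l w l * u l) + w j * (\sum_l w l * u l ^+ 2))).
  apply: eq_bigr => j _; rewrite !mulr_sumr -sumrB -big_split.
  by apply: eq_bigr => l _ /=; ring.
rewrite big_split sumrB -!mulr_suml w1 -mulr_sumr /=; ring.
Qed.

(* Writing E(u) for the mean over i ~ p of the pairwise variance of u under
   row i of A, stationarity gives |(A - 1 p^T) u|^2 = Var_p u - E(u) / 2, and
   Var_p u is bounded by a multiple of E(u) by chaining along paths. *)
Lemma stochastic_contraction (A : 'M[R]_N) (p : 'cV[R]_N) :
  row_stochastic A -> (forall i, 0 < A i i) -> irreducible_mx A ->
  (forall i, 0 < p i ord0) -> sums_to_one p -> p^T *m A = p^T ->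
  exists2 q : R, 0 <= q < 1 & forall u,
    cvnorm (w_pi p) ((A - const_mx 1 *m p^T) *m u) <= q * cvnorm (w_pi p) u.
Proof.
move=> [A0 A1] Aii Airr p0 p1 pA.
have pE j : \sum_i p i ord0 * A i j = p j ord0.
  move/matrixP: pA => /(_ ord0 j); rewrite !mxE => <-.
  by apply: eq_bigr => i _; rewrite mxE.
have p0' i := ltW (p0 i).
pose E (u : 'I_N -> R) :=
  \sum_i p i ord0 * \sum_j \sum_l A i j * A i l * (u j - u l) ^+ 2.
have term_ge0 (u : 'I_N -> R) i j l : 0 <= A i j * A i l * (u j - u l) ^+ 2.
  by rewrite mulr_ge0 ?sqr_ge0 ?mulr_ge0.
have row_ge0 u i j : 0 <= \sum_l A i j * A i l * (u j - u l) ^+ 2.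
  by apply: sumr_ge0 => l _.
have rows_ge0 u i :
    0 <= p i ord0 * \sum_j \sum_l A i j * A i l * (u j - u l) ^+ 2.
  by rewrite mulr_ge0// sumr_ge0.
have E_ge0 u : 0 <= E u by apply: sumr_ge0.
(* The positive diagonal enters here: row [i] puts weight on [i] itself, so its variance compares
   [u i] with [u k] for every edge from [i] to [k]. *)
have E_edge u i k :
    p i ord0 * (A i i * A i k * (u i - u k) ^+ 2) <= E u.
  rewrite /E (bigD1 i)//= ler_wpDr ?sumr_ge0// ler_wpM2l//.
  rewrite (bigD1 i)//= ler_wpDr ?sumr_ge0//.
  by rewrite (bigD1 k)//= ler_wpDr ?sumr_ge0.
have pairs (ij : 'I_N * 'I_N) : exists C : R, 0 <= C /\
    forall u : 'I_N -> R, (u ij.1 - u ij.2) ^+ 2 <= C * E u.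
  case: ij => i j /=; move: (Airr i j).
  pose P k := exists C : R, 0 <= C /\
    forall u : 'I_N -> R, (u i - u k) ^+ 2 <= C * E u.
  move=> /(connect_invariant (P := P)); apply; last first.
    by exists 0; split => // u; rewrite subrr expr0n mul0r.
  move=> a c /= Aac [C [C0 hC]].
  have pos : 0 < p a ord0 * (A a a * A a c) by rewrite !mulr_gt0.
  (* One more edge costs (s + t)^2 <= 2 s^2 + 2 t^2. *)
  exists (2 * C + 2 * (p a ord0 * (A a a * A a c))^-1); split.
    by rewrite addr_ge0 ?mulr_ge0// invr_ge0 ltW.
  move=> u; have h1 := hC u.
  have h2 : (u a - u c) ^+ 2 <= (p a ord0 * (A a a * A a c))^-1 * E u.
    by rewrite mulrC ler_pdivlMr// mulrC -mulrA E_edge.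
  have : (u i - u c) ^+ 2 <= 2 * (u i - u a) ^+ 2 + 2 * (u a - u c) ^+ 2.
    rewrite -subr_ge0 [leRHS](_ : _ = ((u i - u a) - (u a - u c)) ^+ 2) ?sqr_ge0//.
    by ring.
  lra.
have [C hC] := choice pairs.
pose K := 1 + \sum_i \sum_j p i ord0 * p j ord0 * C (i, j).
have K1 : 1 <= K.
  rewrite lerDl; apply: sumr_ge0 => i _; apply: sumr_ge0 => j _.
  by rewrite !mulr_ge0//; case: (hC (i, j)).
have K0 : 0 < K by lra.
(* The estimate [var_le] below yields a factor 1 - 1/K on the squared norm. Keeping a quarter of
   this gain, with [K >= 1], leaves a radicand of at least 3/4. *)
exists (Num.sqrt (1 - K^-1 / 4)).
  have : 0 < K^-1 <= 1 by rewrite invr_gt0 K0 invf_le1.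
  move=> /andP[k0 k1]; rewrite sqrtr_ge0 -[ltRHS]sqrtr1 ltr_sqrt//.
  by lra.
move=> u; have w0 i : 0 <= w_pi p i by exact: p0'.
rewrite -(ler_pXn2r (ltn0Sn 1)) ?nnegrE ?mulr_ge0 ?sqrtr_ge0//.
rewrite exprMn [X in _ <= X * _]sqr_sqrtr; last first.
  have ? : K^-1 <= 1 by rewrite invf_le1.
  by lra.
rewrite /cvnorm !wnorm_sqr//.
pose f i := u i ord0; pose m := \sum_i p i ord0 * f i.
pose g i := \sum_j A i j * f j.
have AJ i : ((A - const_mx 1 *m p^T) *m u) i ord0 = g i - m.
  rewrite mulmxBl mxE [X in _ + X]mxE -mulmxA; congr (_ - _); first by rewrite mxE.
  rewrite mxE big_ord1 !mxE mul1r; apply: eq_bigr => j _.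
  by rewrite mxE.
have gm : \sum_i p i ord0 * g i = m.
  rewrite /g; under eq_bigr do rewrite mulr_sumr.
  rewrite exchange_big; apply: eq_bigr => j _ /=.
  by rewrite -pE mulr_suml; apply: eq_bigr => i _; rewrite mulrA.
have expand c : \sum_i p i ord0 * (g i - c) ^+ 2 = \sum_i p i ord0 * g i ^+ 2
    - 2 * c * (\sum_i p i ord0 * g i) + c ^+ 2 * (\sum_i p i ord0).
  rewrite !mulr_sumr -sumrB -big_split; apply: eq_bigr => i _ /=; ring.
have varE : \sum_i p i ord0 * (g i - m) ^+ 2 =
    (\sum_i p i ord0 * f i ^+ 2 - m ^+ 2) - E f / 2.
  transitivity (\sum_i p i ord0 * g i ^+ 2 - m ^+ 2).
    by rewrite expand gm p1; ring.
  have -> : E f = 2 * (\sum_i p i ord0 * f i ^+ 2 - \sum_i p i ord0 * g i ^+ 2).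
    rewrite /E; under eq_bigr do rewrite (variance_pairs _ (A1 _)) mulrCA.
    rewrite -mulr_sumr; congr (_ * _).
    under eq_bigr do rewrite mulrBr.
    rewrite sumrB; congr (_ - _).
    under eq_bigr do rewrite mulr_sumr.
    rewrite exchange_big; apply: eq_bigr => j _ /=.
    by rewrite -(pE j) mulr_suml; apply: eq_bigr => i _; rewrite mulrA.
  by field.
have var_le : \sum_i p i ord0 * f i ^+ 2 - m ^+ 2 <= K / 2 * E f.
  suff ? : 2 * (\sum_i p i ord0 * f i ^+ 2 - m ^+ 2) <= K * E f by lra.
  rewrite -(variance_pairs f p1) /K mulrDl mul1r ler_wpDl//.
  rewrite mulr_suml ler_sum// => i _; rewrite mulr_suml ler_sum// => j _.
  rewrite -[leRHS]mulrA ler_wpM2l ?mulr_ge0//.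
  by case: (hC (i, j)) => _; apply.
have var_ge0 : 0 <= \sum_i p i ord0 * f i ^+ 2 - m ^+ 2.
  suff ? : 0 <= 2 * (\sum_i p i ord0 * f i ^+ 2 - m ^+ 2) by lra.
  rewrite -(variance_pairs f p1); apply: sumr_ge0 => i _; apply: sumr_ge0 => j _.
  by rewrite mulr_ge0 ?sqr_ge0 ?mulr_ge0.
have EK : K^-1 * (\sum_i p i ord0 * f i ^+ 2 - m ^+ 2) <= E f / 2.
  by rewrite mulrC ler_pdivrMr// mulrC; lra.
have m2 : 0 <= K^-1 * m ^+ 2 by rewrite mulr_ge0 ?sqr_ge0// invr_ge0 ltW.
have S0 : 0 <= K^-1 * \sum_i p i ord0 * f i ^+ 2.
  rewrite mulr_ge0 ?invr_ge0 ?(ltW K0)// sumr_ge0// => i _.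
  by rewrite mulr_ge0 ?sqr_ge0.
have m2' : 0 <= m ^+ 2 by rewrite sqr_ge0.
have Kle : K^-1 <= 1 by rewrite invf_le1.
under eq_bigr do rewrite real_normK ?num_real// AJ.
under [in leRHS]eq_bigr do rewrite real_normK ?num_real//.
rewrite /w_pi varE -/(f _); nra.
Qed.

End StochasticMatrices.

(** * Limits of matrix powers, and contraction in the column-stochastic case *)

Section MatrixLimits.
Context {R : realType} {N : nat}.

(** The relations AK = KA = KK = K give A^k - K = (A - K)^k for k >= 1, and the contraction makes
    every entry of the right-hand side decay geometrically. *)
Lemma mx_infty_eq (w : 'I_N -> R) (A K : 'M[R]_N) q :
  (forall i, 0 < w i) -> 0 <= q < 1 ->
  A *m K = K -> K *m A = K -> K *m K = K ->
  (forall u, cvnorm w ((A - K) *m u) <= q * cvnorm w u) ->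
  mx_infty A = K.
Proof.
move=> w0 /andP[q0 q1] AK KA KK hq.
have w0' i := ltW (w0 i).
have KpowA k : K *m A ^+ k = K.
  by elim: k => [|k IH]; rewrite ?expr0 ?mulmx1// exprSr -mulmxE mulmxA IH.
have powE k : A ^+ k.+1 - K = (A - K) ^+ k.+1.
  elim: k => [|k IH]; first by rewrite !expr1.
  rewrite exprS [RHS]exprS -IH -!mulmxE mulmxBl !mulmxBr AK KK KpowA.
  by rewrite subrr subr0.
have Gpow k u : cvnorm w ((A - K) ^+ k *m u) <= q ^+ k * cvnorm w u.
  elim: k u => [|k IH] u; first by rewrite !expr0 mul1mx mul1r.
  rewrite !exprS -mulmxE -mulmxA (le_trans (hq _))// -mulrA.
  by rewrite ler_wpM2l.
pose d j : 'cV[R]_N := delta_mx j ord0.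
pose c := \sum_i \sum_j (Num.sqrt (w i))^-1 * cvnorm w (d j).
have entry k i j : `|(A ^+ k.+1 - K) i j| <= c * q ^+ k.+1.
  have -> : (A ^+ k.+1 - K) i j = ((A - K) ^+ k.+1 *m d j) i ord0.
    by rewrite powE -colE mxE.
  apply: le_trans (norm_coord_le_wnorm
    (fun i => ((A - K) ^+ k.+1 *m d j) i ord0) i w0) _.
  apply: le_trans (_ : _ <= (Num.sqrt (w i))^-1
      * (q ^+ k.+1 * cvnorm w (d j))) _.
    by rewrite ler_wpM2l ?invr_ge0 ?sqrtr_ge0// Gpow.
  rewrite mulrCA mulrC ler_wpM2r ?exprn_ge0//.
  have pos a b : 0 <= (Num.sqrt (w a))^-1 * cvnorm w (d b).
    by rewrite mulr_ge0 ?invr_ge0 ?sqrtr_ge0 ?wnorm_ge0.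
  rewrite /c (bigD1 i)//= ler_wpDr//.
    by apply: sumr_ge0 => a _; apply: sumr_ge0.
  by rewrite (bigD1 j)//= ler_wpDr// sumr_ge0.
have c0 : 0 <= c.
  apply: sumr_ge0 => i _; apply: sumr_ge0 => j _.
  by rewrite mulr_ge0 ?invr_ge0 ?sqrtr_ge0 ?wnorm_ge0.
apply: cvg_lim; first exact: norm_hausdorff.
apply: (cvg_sub0 (f := GRing.exp A) (g := fun=> K)); last exact: cvg_cst.
apply: norm_cvg0.
apply: (squeeze_cvgr (f := fun=> 0) (g := fun k => `|A ^+ k - K|)
  (h := fun k => c * q ^+ k)).
(* The bound is claimed from exponent 1 on: at exponent 0 the power identity would read I - K =
   I. *)
- exists 1%N => // -[//|k] _ /=.
  rewrite normr_ge0 andTb.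
  rewrite -[X in X <= _]/(mx_norm (A ^+ k.+1 - K)).
  have [->|] := eqVneq (mx_norm (A ^+ k.+1 - K)) 0.
    by rewrite mulr_ge0 ?exprn_ge0.
  by move=> /mx_norm_neq0[ij ->].
- exact: cvg_cst.
- rewrite -[X in _ --> X](mulr0 c); apply: cvgM; first exact: cvg_cst.
  by apply: cvg_expr; rewrite ger0_norm.
Qed.

(** Off the diagonal the support graph of [A] is [e] with all edges reversed, and reversal preserves
    strong connectivity. *)
Lemma irreducible_consistent (e : rel 'I_N) (A : 'M[R]_N) :
  simple_digraph e -> strongly_connected e -> consistent e A ->
  irreducible_mx A.
Proof.
move=> he hconn hA i j.
have : connect [rel x y | e y x] i j by rewrite (connect_rev e) /= hconn.
apply: connect_sub => a b /= eba; apply: connect1 => /=.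
by rewrite hA//; apply: contraTneq eba => ->; rewrite he.
Qed.

Lemma irreducible_trmx (A : 'M[R]_N) : irreducible_mx A -> irreducible_mx A^T.
Proof.
move=> Airr i j.
have : connect [rel x y | 0 < A y x] i j.
  by rewrite (connect_rev [rel x y | 0 < A x y]) /= Airr.
apply: connect_sub => a b /= Aba.
by apply: connect1; rewrite /= mxE.
Qed.

Lemma mx_infty_row_stochastic (A : 'M[R]_N) (p : 'cV[R]_N) q :
  row_stochastic A -> (forall i, 0 < p i ord0) -> sums_to_one p ->
  p^T *m A = p^T -> 0 <= q < 1 ->
  (forall u, cvnorm (w_pi p) ((A - const_mx 1 *m p^T) *m u)
             <= q * cvnorm (w_pi p) u) ->
  mx_infty A = const_mx 1 *m p^T.
Proof.
move=> [A0 A1] p0 p1 pA hq hqu.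
have p1' : p^T *m (const_mx 1 : 'cV[R]_N) = 1%:M.
  apply/matrixP => i j; rewrite !ord1 !mxE -[RHS]p1.
  by apply: eq_bigr => k _; rewrite !mxE mulr1.
apply: (mx_infty_eq (w := w_pi p)) hqu => //.
- rewrite mulmxA; congr (_ *m _); apply/matrixP => i j.
  rewrite !mxE -[RHS](A1 i).
  by apply: eq_bigr => k _; rewrite mxE mulr1.
- by rewrite -mulmxA pA.
- by rewrite mulmxA -[_ *m p^T *m _]mulmxA p1' mulmx1.
Qed.

Lemma mx_infty_col_stochastic (B : 'M[R]_N) (v : 'cV[R]_N) q :
  col_stochastic B -> (forall i, 0 < v i ord0) -> sums_to_one v ->
  B *m v = v -> 0 <= q < 1 ->
  (forall u, cvnorm (w_nu v) ((B - v *m const_mx 1) *m u)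
             <= q * cvnorm (w_nu v) u) ->
  mx_infty B = v *m const_mx 1.
Proof.
move=> [B0 B1] v0 v1 Bv hq hqu.
have v1' : (const_mx 1 : 'rV[R]_N) *m v = 1%:M.
  apply/matrixP => i j; rewrite !ord1 !mxE -[RHS]v1.
  by apply: eq_bigr => k _; rewrite !mxE mul1r.
apply: (mx_infty_eq (w := w_nu v)) hqu => //.
- by move=> i; rewrite invr_gt0.
- by rewrite mulmxA Bv.
- rewrite -mulmxA; congr (_ *m _); apply/matrixP => i j.
  rewrite !mxE -[RHS](B1 j).
  by apply: eq_bigr => k _; rewrite mxE mul1r.
- by rewrite mulmxA -[v *m _ *m v]mulmxA v1' mulmx1.
Qed.

(* The row-stochastic matrix D^-1 B D, D = diag v, has stationary vector v, and
   u |-> D u is an isometry from the norm weighted by v to that weighted by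
   1 / v. *)
Lemma col_stochastic_contraction (B : 'M[R]_N) (v : 'cV[R]_N) :
  col_stochastic B -> (forall i, 0 < B i i) -> irreducible_mx B ->
  (forall i, 0 < v i ord0) -> sums_to_one v -> B *m v = v ->
  exists2 q : R, 0 <= q < 1 & forall u,
    cvnorm (w_nu v) ((B - v *m const_mx 1) *m u) <= q * cvnorm (w_nu v) u.
Proof.
move=> [B0 B1] Bii Birr v0 v1 Bv.
have v0' i := ltW (v0 i).
have v_neq0 i : v i ord0 != 0 by rewrite gt_eqF.
have vE i : \sum_j B i j * v j ord0 = v i ord0.
  by move/matrixP: Bv => /(_ i ord0); rewrite mxE.
pose A : 'M[R]_N := \matrix_(i, j) (B i j * v j ord0 / v i ord0).
have [||||q hq hqu] := @stochastic_contraction R N A v _ _ _ v0 v1.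
- split=> [i j|i]; first by rewrite mxE !mulr_ge0 ?invr_ge0.
  under eq_bigr do rewrite mxE.
  by rewrite -mulr_suml vE mulfV.
- by move=> i; rewrite mxE !mulr_gt0 ?invr_gt0.
- move=> i j; apply: connect_sub (Birr i j) => a b /= Bab.
  by apply: connect1; rewrite /= mxE !mulr_gt0 ?invr_gt0.
- apply/matrixP => a j; rewrite !mxE -[RHS]mul1r -(B1 j) mulr_suml.
  by apply: eq_bigr => i _; rewrite !mxE ord1; field; rewrite v_neq0.
exists q => // z; pose u : 'cV[R]_N := \col_i (z i ord0 / v i ord0).
have isom (s t : 'cV[R]_N) : (forall i, s i ord0 = v i ord0 * t i ord0) ->
    cvnorm (w_nu v) s = cvnorm (w_pi v) t.
  move=> st; congr Num.sqrt; apply: eq_bigr => i _.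
  rewrite !real_normK ?num_real// st /w_nu /w_pi.
  by field; rewrite v_neq0.
have zu i : z i ord0 = v i ord0 * u i ord0 by rewrite mxE mulrC divfK.
rewrite (isom _ _ zu); apply: le_trans (hqu u).
rewrite (isom _ ((A - const_mx 1 *m v^T) *m u))// => i.
rewrite !mulmxBl mxE [X in _ + X]mxE [X in _ = _ * X]mxE.
rewrite [X in _ = _ * (_ + X)]mxE -!mulmxA mulrBr; congr (_ - _).
  rewrite !mxE mulr_sumr; apply: eq_bigr => j _; rewrite !mxE.
  by field; rewrite !v_neq0.
rewrite !mxE !big_ord1 !mxE mul1r; congr (_ * _).
by apply: eq_bigr => j _; rewrite !mxE mul1r mulrC divfK.
Qed.

End MatrixLimits.

(** * The 3 x 3 comparison system *)

Section StepMatrix.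
Context {R : realType}.

(** Entries indexed by [nat] let the ordinals of the cofactor expansion compute to numerals, and
    match the [nth] form of [Mstep]. *)
Lemma det3 (f : nat -> nat -> R) :
  \det (\matrix_(i < 3, j < 3) f i j) =
  f 0%N 0%N * (f 1%N 1%N * f 2%N 2%N - f 1%N 2%N * f 2%N 1%N)
  - f 0%N 1%N * (f 1%N 0%N * f 2%N 2%N - f 1%N 2%N * f 2%N 0%N)
  + f 0%N 2%N * (f 1%N 0%N * f 2%N 1%N - f 1%N 1%N * f 2%N 0%N).
Proof.
rewrite (expand_det_row _ ord0) !big_ord_recl big_ord0 /cofactor.
rewrite !(expand_det_row _ (ord0 : 'I_2)) !big_ord_recl !big_ord0 /cofactor.
rewrite !det_mx11 !mxE /= /bump /=; ring.
Qed.

(** A nonpositive value at [a] would, by the intermediate value theorem, give a root in (0, a],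
    below [ac]. *)
Lemma polynomial_pos_before_root (P : {poly R}) ac a :
  0 < P.[0] -> (forall b, 0 < b -> P.[b] = 0 -> ac <= b) -> 0 < a < ac ->
  0 < P.[a].
Proof.
move=> P0 Pac /andP[a0 aac]; rewrite ltNge; apply/negP => Pa.
have [|b /andP[b0 ba]] := @poly_ivt R (- P) 0 a (ltW a0).
  by rewrite !hornerN oppr_le0 oppr_ge0 Pa ltW.
rewrite rootE hornerN oppr_eq0 => /eqP Pb.
have bpos : 0 < b.
  rewrite lt_neqAle b0 andbT eq_sym; apply: contraTneq P0 => b00.
  by rewrite -[X in P.[X]]b00 Pb ltxx.
by have := Pac _ bpos Pb; rewrite leNgt (le_lt_trans ba).
Qed.

(* [f a = a * g.[a]] for a polynomial [g] with [g.[0] = (1 - r1) (1 - r2) s]. *)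
Lemma step_det_pos (r1 r2 s m12 m21 m21' m22 m23 m31 m32 ac a : R) :
  let f a := (1 - (1 - a) * r1)
      * ((1 - (r2 + a * m22)) * (1 - (1 - s * a)) - a * m23 * (a * m32))
    - a * m12 * ((m21 + a * m21') * (1 - (1 - s * a)) + a * m23 * (a * m31)) in
  r1 < 1 -> r2 < 1 -> 0 < s -> (forall b, 0 < b -> f b = 0 -> ac <= b) ->
  0 < a < ac -> 0 < f a.
Proof.
move=> f r1_lt1 r2_lt1 s0 fac aac.
pose g : {poly R} := (1 - (1 - 'X) * r1%:P)
      * ((1 - (r2%:P + 'X * m22%:P)) * s%:P - m23%:P * m32%:P * 'X)
    - m12%:P * 'X * ((m21%:P + 'X * m21'%:P) * s%:P + m23%:P * m31%:P * 'X).
have fE b : f b = b * g.[b].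
  by rewrite /f /g !hornerE /=; ring.
have a0 : 0 < a by case/andP: aac.
rewrite fE mulr_gt0//; apply: polynomial_pos_before_root aac.
  rewrite /g !hornerE !(mul0r, mulr0, subr0, addr0, mul1r).
  by rewrite !mulr_gt0 ?subr_gt0.
by move=> b b0 gb; apply: fac => //; rewrite fE gb mulr0.
Qed.

(* [(w1, w2, w3)] is the adjugate of [I - M] applied to [(1, 1, 1)], so that
   [(I - M) w = det (I - M) (1, 1, 1)]. *)
Lemma perron_vector3 (m11 m12 m21 m22 m23 m31 m32 m33 : R) :
  0 <= m12 -> 0 <= m21 -> 0 <= m23 -> 0 <= m31 -> 0 <= m32 ->
  m11 < 1 -> m33 < 1 ->
  0 < (1 - m11) * ((1 - m22) * (1 - m33) - m23 * m32)
      - m12 * (m21 * (1 - m33) + m23 * m31) ->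
  exists w1 w2 w3 r : R, [/\ [/\ 0 < w1, 0 < w2 & 0 < w3], 0 < r < 1,
    m11 * w1 + m12 * w2 <= r * w1,
    m21 * w1 + m22 * w2 + m23 * w3 <= r * w2 &
    m31 * w1 + m32 * w2 + m33 * w3 <= r * w3].
Proof.
move=> h12 h21 h23 h31 h32 h11 h33; set D := (X in 0 < X) => D0.
have [a [aE a0]] : exists a, a = 1 - m11 /\ 0 < a
  by exists (1 - m11); rewrite subr_gt0.
have [h [hE h0]] : exists h, h = 1 - m33 /\ 0 < h
  by exists (1 - m33); rewrite subr_gt0.
have [d dE] : exists d, d = 1 - m22 by exists (1 - m22).
have DE : D = a * (d * h - m23 * m32) - m12 * (m21 * h + m23 * m31).
  by rewrite /D aE hE dE.
have c1 : 0 <= m12 * (m21 * h + m23 * m31).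
  by rewrite mulr_ge0 ?addr_ge0 ?mulr_ge0// ltW.
(* From here to [q3], each minor of I - M multiplied by [a] or [h] is [D], or an earlier positive
   quantity, plus nonnegative terms; in particular [m22 < 1] follows. *)
have q1 : 0 < d * h - m23 * m32 by rewrite -(pmulr_rgt0 _ a0); lra.
have q2 : 0 <= m12 * h + m12 * m23 by rewrite addr_ge0 ?mulr_ge0// ltW.
have d0 : 0 < d.
  rewrite -(pmulr_lgt0 _ h0); have : 0 <= m23 * m32 by rewrite mulr_ge0.
  lra.
have q3 : 0 < a * d - m12 * m21.
  rewrite -(pmulr_lgt0 _ h0).
  have : 0 <= a * (m23 * m32) by rewrite !mulr_ge0// ltW.
  have : 0 <= m12 * (m23 * m31) by rewrite !mulr_ge0.
  lra.
pose w1 := d * h - m23 * m32 + m12 * h + m12 * m23.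
pose w2 := m21 * h + m23 * m31 + a * h + a * m23.
pose w3 := m21 * m32 + d * m31 + (a * m32 + m12 * m31) + (a * d - m12 * m21).
have w1_gt0 : 0 < w1 by rewrite /w1; lra.
have w2_gt0 : 0 < w2.
  have : 0 < a * h by rewrite mulr_gt0.
  have : 0 <= m21 * h by rewrite mulr_ge0// ltW.
  have : 0 <= m23 * m31 by rewrite mulr_ge0.
  have : 0 <= a * m23 by rewrite mulr_ge0// ltW.
  by rewrite /w2; lra.
have w3_gt0 : 0 < w3.
  have : 0 <= m21 * m32 by rewrite mulr_ge0.
  have : 0 <= d * m31 by rewrite mulr_ge0// ltW.
  have : 0 <= a * m32 by rewrite mulr_ge0// ltW.
  have : 0 <= m12 * m31 by rewrite mulr_ge0.
  by rewrite /w3; lra.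
pose W := w1 + w2 + w3.
have W0 : 0 < W by rewrite /W; lra.
(* Since M w = w - D (1, 1, 1), the rate 1 - eps works once eps * w_i <= D for all i; the bound 1/2
   keeps the rate positive. *)
pose eps := Num.min 2^-1 (D / W).
have eps0 : 0 < eps by rewrite lt_min invr_gt0 ltr0n divr_gt0.
have ew (w : R) : 0 < w -> 0 <= eps * w by move=> ?; rewrite mulr_ge0// ltW.
have := (ew _ w1_gt0, ew _ w2_gt0, ew _ w3_gt0); move=> [[ew1 ew2] ew3].
have eps_half : eps <= 2^-1 by rewrite ge_min lexx.
have epsW : eps * w1 + eps * w2 + eps * w3 <= D.
  by rewrite -!mulrDr -/W -ler_pdivlMr// ge_min lexx orbT.
exists w1, w2, w3, (1 - eps); split; [by split|lra| | |].
- have -> : m11 * w1 + m12 * w2 = w1 - D.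
    by rewrite DE /w1 /w2 (_ : m11 = 1 - a) ?aE; ring.
  by rewrite mulrBl mul1r lerD2l lerN2; lra.
- have -> : m21 * w1 + m22 * w2 + m23 * w3 = w2 - D.
    by rewrite DE /w1 /w2 /w3 (_ : m22 = 1 - d) ?dE; ring.
  by rewrite mulrBl mul1r lerD2l lerN2; lra.
- have -> : m31 * w1 + m32 * w2 + m33 * w3 = w3 - D.
    by rewrite DE /w1 /w2 /w3 (_ : m33 = 1 - h) ?hE; ring.
  by rewrite mulrBl mul1r lerD2l lerN2; lra.
Qed.

(* [m33] may be negative, but then [0 <= m33 * z3 k] forces [z3] to vanish. *)
Lemma geometric_decay3 (m11 m12 m21 m22 m23 m31 m32 m33 w1 w2 w3 r : R)
    (z1 z2 z3 : nat -> R) :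
  0 <= m11 -> 0 <= m12 -> 0 <= m21 -> 0 <= m22 -> 0 <= m23 -> 0 <= m31 ->
  0 <= m32 -> 0 < w1 -> 0 < w2 -> 0 < w3 -> 0 < r ->
  m11 * w1 + m12 * w2 <= r * w1 ->
  m21 * w1 + m22 * w2 + m23 * w3 <= r * w2 ->
  m31 * w1 + m32 * w2 + m33 * w3 <= r * w3 ->
  (forall k, 0 <= z1 k) -> (forall k, 0 <= z2 k) -> (forall k, 0 <= z3 k) ->
  (forall k, 0 <= m33 * z3 k) ->
  (forall k, z1 k.+1 <= m11 * z1 k + m12 * z2 k) ->
  (forall k, z2 k.+1 <= m21 * z1 k + m22 * z2 k + m23 * z3 k) ->
  (forall k, z3 k.+1 <= m31 * z1 k + m32 * z2 k + m33 * z3 k) ->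
  exists2 C : R, 0 < C & forall k,
    [/\ z1 k <= C * r ^+ k, z2 k <= C * r ^+ k & z3 k <= C * r ^+ k].
Proof.
move=> h11 h12 h21 h22 h23 h31 h32 w1_gt0 w2_gt0 w3_gt0 r0 e1 e2 e3.
move=> p1 p2 p3 p33 s1 s2 s3.
pose K := z1 0%N / w1 + z2 0%N / w2 + z3 0%N / w3 + 1.
have q1 : 0 <= z1 0%N / w1 by rewrite divr_ge0// ltW.
have q2 : 0 <= z2 0%N / w2 by rewrite divr_ge0// ltW.
have q3 : 0 <= z3 0%N / w3 by rewrite divr_ge0// ltW.
have K0 : 0 < K by rewrite /K; lra.
have main k : [/\ z1 k <= K * r ^+ k * w1, z2 k <= K * r ^+ k * w2
    & z3 k <= K * r ^+ k * w3].
  elim: k => [|k [i1 i2 i3]].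
    by rewrite expr0 mulr1 -!ler_pdivrMr//; split; rewrite /K; lra.
  have rk : 0 < K * r ^+ k by rewrite mulr_gt0 ?exprn_gt0.
  move: rk i1 i2 i3; rewrite exprSr mulrA; set c := K * r ^+ k => rk i1 i2 i3.
  have t11 := ler_wpM2l h11 i1; have t12 := ler_wpM2l h12 i2.
  have t21 := ler_wpM2l h21 i1; have t22 := ler_wpM2l h22 i2.
  have t23 := ler_wpM2l h23 i3; have t31 := ler_wpM2l h31 i1.
  have t32 := ler_wpM2l h32 i2.
  have u1 := ler_wpM2l (ltW rk) e1; have u2 := ler_wpM2l (ltW rk) e2.
  have u3 := ler_wpM2l (ltW rk) e3.
  split.
  - by apply: le_trans (s1 k) _; lra.
  - by apply: le_trans (s2 k) _; lra.
  - have [m33_ge0|m33_lt0] := leP 0 m33.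
      have t33 := ler_wpM2l m33_ge0 i3.
      by apply: le_trans (s3 k) _; lra.
    have : z3 k.+1 <= 0 by have := p33 k.+1; rewrite nmulr_rge0.
    move=> /le_trans; apply.
    exact: mulr_ge0 (mulr_ge0 (ltW rk) (ltW r0)) (ltW w3_gt0).
exists (K * (w1 + w2 + w3)) => [|k].
  by apply: mulr_gt0 => //; rewrite !addr_gt0.
have rk : 0 < K * r ^+ k by rewrite mulr_gt0 ?exprn_gt0.
have [i1 i2 i3] := main k.
by rewrite mulrAC; split; [apply: le_trans i1 _|apply: le_trans i2 _|
  apply: le_trans i3 _]; rewrite ler_pM2l//; lra.
Qed.

End StepMatrix.

(** * Distances and averaged operators in Hilbert space *)

Section GeometricSequences.
Context {R : realType}.

Lemma geometric_vanish (a C r : R) : 0 <= a -> 0 < r < 1 ->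
  (forall k, a <= C * r ^+ k) -> a = 0.
Proof.
move=> a0 /andP[r0 r1] ha; apply/le_anti; rewrite a0 andbT.
have Cr : C * r ^+ k @[k --> \oo] --> (0 : R).
  rewrite -[X in _ --> X](mulr0 C); apply: cvgM; first exact: cvg_cst.
  by apply: cvg_expr; rewrite ger0_norm// ltW.
rewrite -(cvg_lim (@Rhausdorff R) Cr); apply: limr_ge.
  by apply/cvg_ex; exists 0.
by apply: nearW => k; exact: ha.
Qed.

Lemma geometric_increments_cvg (H : completeNormedModType R) (u : nat -> H)
    (C r : R) : 0 < r < 1 -> (forall k, `|u k.+1 - u k| <= C * r ^+ k) ->
  exists l, forall k, `|u k - l| <= C / (1 - r) * r ^+ k.
Proof.
move=> /andP[r0 r1] hu.
have r1' : 0 < 1 - r by rewrite subr_gt0.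
have C0 : 0 <= C by have := hu 0%N; rewrite expr0 mulr1; apply: le_trans.
pose s k := u k.+1 - u k.
have cvg_s : cvgn (series s).
  apply: normed_cvg.
  apply: (@series_le_cvg _ _ (geometric C r)) => [k|k|k|] //=.
  - by rewrite mulr_ge0// exprn_ge0// ltW.
  - exact: hu.
  - by apply: is_cvg_geometric_series; rewrite ger0_norm// ltW.
exists (u 0%N + limn (series s)) => k.
have uE n : u n = u 0%N + series s n.
  by rewrite /series /= telescope_sumr// addrC subrK.
(* The sharp partial geometric sum is kept, so that the induction step closes with an equality. *)
have tail m : `|u (k + m)%N - u k| <= C / (1 - r) * r ^+ k * (1 - r ^+ m).
  elim: m => [|m IH]; first by rewrite addn0 subrr normr0 expr0 subrr mulr0.
  rewrite addnS -(subrK (u (k + m)%N) (u _.+1)) -addrA.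
  apply: le_trans (ler_normD _ _) _; apply: le_trans (lerD (hu _) IH) _.
  rewrite le_eqVlt; apply/orP; left; apply/eqP.
  by rewrite exprD exprS; field; rewrite gt_eqF.
have dist_cvg : `|u (k + m)%N - u k| @[m --> \oo] -->
    `|u 0%N + limn (series s) - u k|.
  apply: cvg_norm; apply: cvgB; last exact: cvg_cst.
  under eq_fun do rewrite uE.
  apply: cvgD; first exact: cvg_cst.
  under eq_fun do rewrite addnC.
  suff : [sequence series s (n + k)%N]_n @ \oo --> limn (series s) by [].
  by rewrite cvg_shiftn.
rewrite distrC -(cvg_lim (@Rhausdorff R) dist_cvg).
apply: limr_le; first by apply/cvg_ex; eexists; exact: dist_cvg.
apply: nearW => m; apply: le_trans (tail m) _.
apply: ler_piMr; last by rewrite gerBl exprn_ge0// ltW.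
exact: mulr_ge0 (divr_ge0 C0 (ltW r1')) (exprn_ge0 _ (ltW r0)).
Qed.

End GeometricSequences.

Section DistanceToSet.
Context {R : realType} {H : normedModType R}.
Implicit Types (X : set H) (z : H).

Lemma dist_to_le X z x : X x -> dist_to X z <= `|z - x|.
Proof.
move=> Xx; apply: ge_inf; last by exists x.
by exists 0 => _ [y _ <-].
Qed.

Lemma dist_to_ge X z c : X !=set0 -> (forall x, X x -> c <= `|z - x|) ->
  c <= dist_to X z.
Proof.
move=> [x Xx] hc; apply: lb_le_inf; first by exists `|z - x|, x.
by move=> _ [y Xy <-]; exact: hc.
Qed.

Lemma dist_to_ge0 X z : X !=set0 -> 0 <= dist_to X z.
Proof. by move=> X0; apply: dist_to_ge. Qed.

Lemma dist_to_lipschitz X z z' : X !=set0 ->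
  dist_to X z <= dist_to X z' + `|z - z'|.
Proof.
move=> X0; rewrite -lerBlDr; apply: dist_to_ge => // x Xx.
rewrite lerBlDr; apply: le_trans (dist_to_le z Xx) _.
by rewrite [leRHS]addrC -(subrKA z') ler_normD.
Qed.

(** For every fixed point x, |F z - z| <= |F z - x| + |x - z| <= 2 |z - x|; this is the origin of
    the factors 2 in the error recursion. *)
Lemma quasi_nonexpansive_displacement (F : H -> H) z : Fix F !=set0 ->
  quasi_nonexpansive F -> `|F z - z| <= 2 * dist_to (Fix F) z.
Proof.
move=> X0 qne; rewrite mulrC -ler_pdivrMr//; apply: dist_to_ge => // x Xx.
rewrite ler_pdivrMr//; have := qne z x Xx.
have := ler_normD (F z - x) (x - z); rewrite subrKA (distrC x z); lra.
Qed.

End DistanceToSet.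

(** * Averaged maps and induced norms in Hilbert space *)

Section Hilbert.
Context {R : realType} {H : completeNormedModType R} (ip : {dot H for idfun}).
Context (hH : norm_of_dot ip).

Lemma ip_sym x y : ip x y = ip y x.
Proof. by rewrite (hermC ip) expr0 mul1r. Qed.

Lemma ipDl x y z : ip (x + y) z = ip x z + ip y z.
Proof. exact: linearDl. Qed.

Lemma ipZl c x y : ip (c *: x) y = c * ip x y.
Proof. exact: linearZl_LR. Qed.

Lemma ip_ge0 x : 0 <= ip x x.
Proof. by rewrite -hH sqr_ge0. Qed.

(** The parallelogram-type identity whose negative last term supplies the decrease in
    [averaged_dist_to]. *)
Lemma norm_convex_comb (a : R) (x y : H) :
  `|(1 - a) *: x + a *: y| ^+ 2 =
  (1 - a) * `|x| ^+ 2 + a * `|y| ^+ 2 - a * (1 - a) * `|x - y| ^+ 2.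
Proof.
have ipDr x' y' z : ip z (x' + y') = ip z x' + ip z y'.
  by rewrite ip_sym ipDl !(ip_sym z).
have ipZr c x' y' : ip x' (c *: y') = c * ip x' y' by rewrite ip_sym ipZl ip_sym.
rewrite !hH -[- y]scaleN1r !(ipDl, ipDr, ipZl, ipZr) (ip_sym y x); ring.
Qed.

(** Against a fixed point x, the squared distance drops by a (1 - a) |F z - z|^2. As 1 - a > delta,
    the error bound makes this at least s D^2 with s = delta a / kappa^2. Taking the infimum gives
    D'^2 <= (1 - s) D^2, and 1 - s <= (1 - s/4)^2. *)
Lemma averaged_dist_to (F : H -> H) (kappa a delta : R) z :
  Fix F !=set0 -> quasi_nonexpansive F -> 0 < kappa ->
  dist_to (Fix F) z <= kappa * `|F z - z| -> 0 < delta -> 0 < a < 1 - delta ->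
  dist_to (Fix F) ((1 - a) *: z + a *: F z)
    <= (1 - delta * a / (4 * kappa ^+ 2)) * dist_to (Fix F) z
  /\ 0 <= (1 - delta * a / (4 * kappa ^+ 2)) * dist_to (Fix F) z.
Proof.
move=> X0 qne kappa0 hreg delta0 /andP[a0 a1].
set T := _ + _; set D := dist_to _ z in hreg *; set D' := dist_to _ T.
have D0 : 0 <= D by exact: dist_to_ge0.
have D'0 : 0 <= D' by exact: dist_to_ge0.
pose s := delta * a / kappa ^+ 2.
have s0 : 0 < s by rewrite divr_gt0 ?mulr_gt0 ?exprn_gt0.
have -> : delta * a / (4 * kappa ^+ 2) = s / 4.
  by rewrite /s; field; rewrite gt_eqF.
have D2 : D ^+ 2 <= kappa ^+ 2 * `|F z - z| ^+ 2.
  by rewrite -exprMn ler_pXn2r ?nnegrE// mulr_ge0// ltW.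
have sD : s * D ^+ 2 <= a * (1 - a) * `|z - F z| ^+ 2.
  rewrite distrC /s mulrAC ler_pdivrMr ?exprn_gt0//.
  apply: le_trans (_ : _ <= delta * a * (kappa ^+ 2 * `|F z - z| ^+ 2)) _.
    by rewrite ler_pM2l ?mulr_gt0.
  rewrite mulrCA mulrC -!mulrA [leRHS](_ : _ =
    a * ((1 - a) * (`|F z - z| ^+ 2 * kappa ^+ 2))); last by ring.
  rewrite [leLHS](_ : _ =
    a * (delta * (`|F z - z| ^+ 2 * kappa ^+ 2))); last by ring.
  rewrite ler_pM2l// ler_wpM2r ?mulr_ge0 ?exprn_ge0 ?(ltW kappa0)//.
  lra.
have key x : Fix F x -> D' ^+ 2 + s * D ^+ 2 <= `|z - x| ^+ 2.
  move=> Xx.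
  have TxE : T - x = (1 - a) *: (z - x) + a *: (F z - x).
    rewrite /T !scalerBr addrACA -opprD -scalerDl.
    by rewrite subrK scale1r.
  have : D' ^+ 2 <= `|T - x| ^+ 2.
    by rewrite ler_pXn2r ?nnegrE// dist_to_le.
  rewrite TxE norm_convex_comb opprB addrA subrK => h1.
  have h2 : `|F z - x| ^+ 2 <= `|z - x| ^+ 2.
    by rewrite ler_pXn2r ?nnegrE// qne.
  have := ler_wpM2l (ltW a0) h2; lra.
have D'D : D' ^+ 2 + s * D ^+ 2 <= D ^+ 2.
  have t0 : 0 <= D' ^+ 2 + s * D ^+ 2.
    by rewrite addr_ge0 ?sqr_ge0// mulr_ge0 ?sqr_ge0// ltW.
  rewrite -[leLHS]sqr_sqrtr// ler_pXn2r ?nnegrE ?sqrtr_ge0//.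
  apply: dist_to_ge => // x Xx.
  by rewrite -[leRHS]normr_id -sqrtr_sqr ler_wsqrtr// key.
have [Dpos|Dneg] := ltP 0 D; last first.
  have D_eq0 : D = 0 by apply/le_anti; rewrite Dneg.
  move: D'D; rewrite D_eq0 expr0n /= !mulr0 addr0 => D'2.
  have : D' = 0 by apply/eqP; rewrite -sqrf_eq0 eq_le D'2 sqr_ge0.
  by move->.
(* For [D > 0] the decrease s D^2 cannot exceed D^2. For [D = 0], treated above, the coefficient may
   have either sign, but it multiplies zero. *)
have s1 : s <= 1.
  have D2pos : 0 < D ^+ 2 by rewrite exprn_gt0.
  rewrite -(ler_pM2r D2pos) mul1r; apply: le_trans D'D.
  by rewrite lerDr sqr_ge0.
have pos : 0 <= (1 - s / 4) * D by rewrite mulr_ge0//; lra.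
split=> //; rewrite -(ler_pXn2r (ltn0Sn 1)) ?nnegrE// exprMn.
have : 0 <= s ^+ 2 * D ^+ 2 by rewrite mulr_ge0 ?sqr_ge0.
have : 0 <= s * D ^+ 2 by rewrite mulr_ge0 ?sqr_ge0// ltW.
lra.
Qed.

Context {N : nat}.

Lemma wnorm_mx (w : 'I_N -> R) (G : 'M[R]_N) (z : 'I_N -> H) :
  (forall i, 0 < w i) ->
  wnorm w (fun i => \sum_j G i j *: z j) <= opnorm w G * wnorm w z.
Proof.
move=> w0; have w0' i := ltW (w0 i).
rewrite -(ler_pXn2r (ltn0Sn 1)) ?nnegrE ?mulr_ge0 ?opnorm_ge0 ?wnorm_ge0//.
rewrite exprMn !wnorm_sqr//.
under eq_bigr do rewrite hH.
under [in leRHS]eq_bigr do rewrite hH.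
exact: (opnorm_form ip_sym ipDl ipZl ip_ge0).
Qed.

(** By the variance identity the squares of the two left-hand sides add up to the square of the
    right-hand side. *)
Lemma weighted_mean_bounds (w : 'I_N -> R) (z : 'I_N -> H) :
  (forall i, 0 < w i) -> \sum_i w i = 1 ->
  let m := \sum_i w i *: z i in
  wnorm w (fun i => z i - m) <= wnorm w z /\ `|m| <= wnorm w z.
Proof.
move=> w0 w1 m; have w0' i := ltW (w0 i).
have := weighted_variance_form ip_sym ipDl ipZl z w1; rewrite /= -/m.
under eq_bigr do rewrite -hH.
under [in X in _ = X - _]eq_bigr do rewrite -hH.
rewrite -!wnorm_sqr// -hH => e.
split; rewrite -(ler_pXn2r (ltn0Sn 1)) ?nnegrE ?wnorm_ge0//.
  by rewrite e gerBl sqr_ge0.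
by rewrite -subr_ge0 -e sqr_ge0.
Qed.

(** Dividing by [v i] turns the projection along [v] into subtraction of a [v]-weighted mean. *)
Lemma wnorm_nu_deviation (v : 'cV[R]_N) (z : 'I_N -> H) :
  (forall i, 0 < v i ord0) -> sums_to_one v ->
  wnorm (w_nu v) (fun i => z i - v i ord0 *: \sum_j z j) <= wnorm (w_nu v) z.
Proof.
move=> v0 v1; have v_neq0 i : v i ord0 != 0 by rewrite gt_eqF.
have isom (s t : 'I_N -> H) : (forall i, s i = v i ord0 *: t i) ->
    wnorm (w_nu v) s = wnorm (w_pi v) t.
  move=> st; congr Num.sqrt; apply: eq_bigr => i _.
  rewrite st normrZ (gtr0_norm (v0 i)) /w_nu /w_pi.
  by field; rewrite v_neq0.
pose t i := (v i ord0)^-1 *: z i.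
have tE i : z i = v i ord0 *: t i by rewrite scalerA mulfV// scale1r.
rewrite (isom _ _ tE) (isom _ (fun i => t i - \sum_j v j ord0 *: t j)).
  by have [] := @weighted_mean_bounds (w_pi v) t v0 v1.
move=> i; rewrite scalerBr -tE; congr (_ - _ *: _).
by apply: eq_bigr => j _; rewrite tE.
Qed.

End Hilbert.

(** * The error recursion *)

Lemma relaxation_increment (R : realType) (V : lmodType R) (a : R) (u z t : V) :
  (1 - a) *: u + a *: z - t = (u - t) + a *: (z - u).
Proof.
by rewrite scalerBl scale1r scalerBr [RHS]addrA [LHS](ACl (1*4*3*2)).
Qed.

Section StepInequalities.
Context {R : realType} {H : completeNormedModType R} (ip : {dot H for idfun}).
Context (hH : norm_of_dot ip) {N : nat} (hN : (0 < N)%N).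
Context (Fs : 'I_N -> H -> H) (L : 'I_N -> R).
Context (hL : forall i, 0 < L i).
Context (hLip : forall i x y, `|Fs i x - Fs i y| <= L i * `|x - y|).
Context (hqne : quasi_nonexpansive (average Fs)).
Context (hFix : Fix (average Fs) !=set0).
Context (kappa : R) (hkappa : 0 < kappa).
Context (hreg : forall x, dist_to (Fix (average Fs)) x
                          <= kappa * `|average Fs x - x|).
Context (A B : 'M[R]_N) (p v : 'cV[R]_N).
Context (hA : row_stochastic A) (hB : col_stochastic B).
Context (hp0 : forall i, 0 < p i ord0) (hv0 : forall i, 0 < v i ord0).
Context (hp1 : sums_to_one p) (hpA : p^T *m A = p^T).
Context (hv1 : sums_to_one v) (hBv : B *m v = v).
Context (hAinf : mx_infty A = const_mx 1 *m p^T).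
Context (hBinf : mx_infty B = v *m const_mx 1).
Context (c1 c2 c3 c4 : R).
Context (hc1 : 0 < c1) (hc2 : 0 < c2) (hc3 : 0 < c3) (hc4 : 0 < c4).
Context (hc : norm_constants H p v c1 c2 c3 c4).
Context (alpha : R) (halpha : 0 < alpha < 1).
Context (x y : nat -> 'I_N -> H) (hxy : DOT_sequence A B v Fs alpha x y).

Let Lbar : R := \big[Num.max/0]_(i < N) L i.
Let sqN : R := Num.sqrt N%:R.
Let rho1 : R := opnorm (w_pi p) (A - mx_infty A).
Let rho2 : R := opnorm (w_nu v) (B - mx_infty B).
Let theta1 : R := c4 * opnorm w_one (invmx (diag_mx v^T)) / N%:R.
Let theta4 : R := opnorm w_one (A - 1%:M).
Let F := average Fs.
Let xb k : H := \sum_i p i ord0 *: x k i.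
Let yb k : H := \sum_i y k i.
Let m k i : H := \sum_j A i j *: x k j.
(** Consensus of y means y_i = v_i yb, so the rescaled y_i / (N v_i) has the consensus value yb / N,
    the same for all i; [g] is the deviation from it. *)
Let g k i : H := (N%:R * v i ord0)^-1 *: (y k i - v i ord0 *: yb k).
Let e1 k : R := wnorm (w_pi p) (fun i => x k i - xb k).
Let e2 k : R := wnorm (w_nu v) (fun i => y k i - v i ord0 *: yb k).
Let e3 k : R := dist_to (Fix F) (xb k).

Let wp0 i : 0 < w_pi p i. Proof. exact: hp0. Qed.
Let wv0 i : 0 < w_nu v i. Proof. by rewrite invr_gt0. Qed.
Let wo0 i : 0 < @w_one R N i. Proof. exact: ltr01. Qed.
Let wp0' i : 0 <= w_pi p i. Proof. exact/ltW. Qed.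
Let wv0' i : 0 <= w_nu v i. Proof. exact/ltW. Qed.
Let wo0' i : 0 <= @w_one R N i. Proof. exact/ltW. Qed.
Let v_neq0 i : v i ord0 != 0. Proof. by rewrite gt_eqF. Qed.
Let N_gt0 : 0 < N%:R :> R. Proof. by rewrite ltr0n. Qed.
Let N_ge1 : 1 <= N%:R :> R. Proof. by rewrite ler1n. Qed.
Let rho1_ge0 : 0 <= rho1. Proof. exact: opnorm_ge0. Qed.
Let rho2_ge0 : 0 <= rho2. Proof. exact: opnorm_ge0. Qed.
Let theta4_ge0 : 0 <= theta4. Proof. exact: opnorm_ge0. Qed.
Let theta1_ge0 : 0 <= theta1.
Proof. by rewrite divr_ge0 ?mulr_ge0 ?opnorm_ge0 ?ltW. Qed.
Let sqN_ge1 : 1 <= sqN. Proof. by rewrite -[leLHS]sqrtr1 ler_sqrt. Qed.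
Let sqN2 : sqN ^+ 2 = N%:R. Proof. by rewrite sqr_sqrtr// ltW. Qed.

Let Lbar_ub i : L i <= Lbar. Proof. exact: le_bigmax. Qed.
Let Lbar_ge0 : 0 <= Lbar.
Proof. exact: le_trans (ltW (hL (Ordinal hN))) (Lbar_ub _). Qed.

(** The identity matrix has norm 1 in all induced norms, so comparing its norms pins [c1] below 1
    and [c2] above 1. Both facts only serve to inflate bounds to the entries of M. *)
Let c1_le1 : c1 <= 1.
Proof.
have [_ _ /(_ 1%:M)[/andP[+ _] _]] := hc.
by rewrite !opnorm1// mulr1.
Qed.

Let c2_ge1 : 1 <= c2.
Proof.
have [_ _ /(_ 1%:M)[/andP[_ +] _]] := hc.
by rewrite !opnorm1// mulr1.
Qed.

Let wnorm_one_pi (z : 'I_N -> H) : wnorm w_one z <= wnorm (w_pi p) z / c1.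
Proof.
by rewrite ler_pdivlMr// mulrC; have [/(_ z)[/andP[+ _] _] _ _] := hc.
Qed.

Let wnorm_pi_one (z : 'I_N -> H) : wnorm (w_pi p) z <= c2 * wnorm w_one z.
Proof. by have [/(_ z)[/andP[_ +] _] _ _] := hc. Qed.

Let wnorm_nu_pi (z : 'I_N -> H) : wnorm (w_nu v) z <= wnorm (w_pi p) z / c3.
Proof.
by rewrite ler_pdivlMr// mulrC; have [/(_ z)[_ /andP[+ _]] _ _] := hc.
Qed.

Let wnorm_pi_nu (z : 'I_N -> H) : wnorm (w_pi p) z <= c4 * wnorm (w_nu v) z.
Proof. by have [/(_ z)[_ /andP[_ +]] _ _] := hc. Qed.

Let inv_v_le i : (v i ord0)^-1 <= opnorm w_one (invmx (diag_mx v^T)).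
Proof.
(* On a singular matrix [invmx] returns its argument, hence the check. *)
have Du : diag_mx v^T \in unitmx.
  rewrite unitmxE det_diag unitfE; apply/prodf_neq0 => j _.
  by rewrite mxE v_neq0.
pose d : 'cV[R]_N := delta_mx i ord0.
have Dd : diag_mx v^T *m d = v i ord0 *: d.
  apply/matrixP => a b; rewrite ord1 mul_diag_mx !mxE eqxx andbT.
  by case: eqVneq => [->|_]; rewrite ?mulr0.
have d1 : cvnorm w_one d = 1.
  rewrite /cvnorm /wnorm (bigD1 i)//= big1 => [|j /negPf ji].
    by rewrite mxE !eqxx normr1 expr1n mulr1 addr0 sqrtr1.
  by rewrite mxE ji normr0 expr0n mulr0.
have := opnorm_ub (invmx (diag_mx v^T)) d wo0; rewrite d1 mulr1.
have -> : invmx (diag_mx v^T) *m d = (v i ord0)^-1 *: d.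
  rewrite -[d in LHS]scale1r -(mulVf (v_neq0 i)) -scalerA -Dd -scalemxAr.
  by rewrite mulKmx.
by rewrite cvnormZ// d1 mulr1 ger0_norm// invr_ge0 ltW.
Qed.

(** The two factors of [theta1]: [K] bounds every (N v_i)^-1, and [c4] passes from the nu-norm to
    the pi-norm. *)
Let g_le k : wnorm (w_pi p) (g k) <= theta1 * e2 k.
Proof.
pose K := opnorm w_one (invmx (diag_mx v^T)) / N%:R.
have K0 : 0 <= K by rewrite divr_ge0 ?opnorm_ge0 ?ltW.
have -> : theta1 * e2 k = K * (c4 * e2 k) by rewrite /theta1 /K; ring.
apply: le_trans (_ : _ <= K * wnorm (w_pi p)
    (fun i => y k i - v i ord0 *: yb k)) _.
  apply: wnorm_dominated => // i.
  rewrite normrZ ler_wpM2r// ger0_norm; last by rewrite invr_ge0 mulr_ge0 ?ltW.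
  by rewrite invfM mulrC ler_pM2r ?invr_gt0.
by rewrite ler_wpM2l// wnorm_pi_nu.
Qed.

Let m_mean k : \sum_i p i ord0 *: m k i = xb k.
Proof.
rewrite /m; under eq_bigr do rewrite scaler_sumr.
rewrite exchange_big; apply: eq_bigr => j _ /=.
under eq_bigr do rewrite scalerA; rewrite -scaler_suml; congr (_ *: _).
move/matrixP: hpA => /(_ ord0 j); rewrite !mxE => <-.
by apply: eq_bigr => i _; rewrite mxE.
Qed.

Let xE k i : x k.+1 i =
  (1 - alpha) *: m k i + alpha *: (g k i + N%:R^-1 *: yb k).
Proof.
have gE : g k i + N%:R^-1 *: yb k = (N%:R * v i ord0)^-1 *: y k i.
  rewrite /g scalerBr scalerA invfM -[X in _ - X *: _]mulrA mulVf// mulr1.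
  by rewrite subrK.
have [_ -> _] := hxy; rewrite gE -/(m k i) scalerBr scalerBl scale1r.
by rewrite [LHS]addrA [LHS]addrAC.
Qed.

Let xbE k : xb k.+1 =
  (1 - alpha) *: xb k
  + alpha *: ((\sum_i p i ord0 *: g k i) + N%:R^-1 *: yb k).
Proof.
have pZ c (z : 'I_N -> H) :
    \sum_i p i ord0 *: (c *: z i) = c *: \sum_i p i ord0 *: z i.
  by rewrite scaler_sumr; apply: eq_bigr => i _; rewrite !scalerA mulrC.
have p_const (c : H) : \sum_i p i ord0 *: c = c.
  by rewrite -scaler_suml (_ : \sum_i _ = 1) ?scale1r.
rewrite {1}/xb; under eq_bigr do rewrite xE scalerDr.
rewrite big_split /= !pZ m_mean /=; congr (_ + _ *: _).
under eq_bigr do rewrite scalerDr.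
by rewrite big_split /= p_const.
Qed.

(** A - A_oo kills constant families, so [xb k] may be subtracted from its input, and A_oo maps x to
    the constant [xb k]. The next two lemmas use in the same way that A - I kills constants and B -
    B_oo kills [v]. *)
Let dev_mx_A k i :
  m k i - xb k = \sum_j (A - mx_infty A) i j *: (x k j - xb k).
Proof.
have entry j : (A - mx_infty A) i j = A i j - p j ord0.
  by rewrite hAinf !mxE big_ord1 !mxE mul1r.
under eq_bigr do rewrite entry scalerBr !scalerBl.
rewrite !sumrB -!scaler_suml.
have -> : \sum_j p j ord0 = 1 by exact: hp1.
have -> : \sum_j A i j = 1 by case: hA.
by rewrite -/(m k i) -/(xb k) !scale1r subrr subr0.
Qed.

Let dev_mx_1 k i :
  m k i - x k i = \sum_j (A - 1%:M) i j *: (x k j - xb k).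
Proof.
under eq_bigr do rewrite mxE [X in _ + X]mxE scalerBr !scalerBl.
rewrite !sumrB -!scaler_suml.
have -> : \sum_j A i j = 1 by case: hA.
have id_sum (f : 'I_N -> H) : \sum_j (1%:M : 'M[R]_N) i j *: f j = f i.
  rewrite (bigD1 i)//= big1 => [|j /negPf ji].
    by rewrite mxE eqxx scale1r addr0.
  by rewrite mxE eq_sym ji scale0r.
by rewrite id_sum scaler_suml id_sum scale1r subrr subr0.
Qed.

Let dev_mx_B k i :
  (\sum_j B i j *: y k j) - v i ord0 *: yb k =
  \sum_j (B - mx_infty B) i j *: (y k j - v j ord0 *: yb k).
Proof.
have entry j : (B - mx_infty B) i j = B i j - v i ord0.
  by rewrite hBinf !mxE big_ord1 !mxE mulr1.
under [RHS]eq_bigr do rewrite entry scalerBr !scalerBl !scalerA.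
rewrite !sumrB -!scaler_suml -mulr_sumr -scaler_sumr.
have -> : \sum_j v j ord0 = 1 by exact: hv1.
have -> : \sum_j B i j * v j ord0 = v i ord0.
  by move/matrixP: hBv => /(_ i ord0); rewrite mxE.
by rewrite mulr1 subrr subr0.
Qed.

(** The term yb / N is common to all i and cancels against the mean, leaving only the deviation of
    [g] from its own mean. *)
Lemma consensus_step k :
  e1 k.+1 <= (1 - alpha) * rho1 * e1 k + alpha * c2 * theta1 * e2 k.
Proof.
have /andP[a0 a1] := halpha; have a1' : 0 <= 1 - alpha by lra.
have -> : e1 k.+1 = wnorm (w_pi p) (fun i => (1 - alpha) *: (m k i - xb k)
    + alpha *: (g k i - \sum_j p j ord0 *: g k j)).
  congr (wnorm _ _); apply/funext => i; rewrite xE xbE.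
  rewrite opprD addrACA -!scalerBr; congr (_ + _ *: _).
  by rewrite opprD addrACA subrr addr0.
apply: le_trans (wnormD _ _ wp0') _.
rewrite -[X in _ <= X + _]mulrA.
have -> : alpha * c2 * theta1 * e2 k = alpha * (c2 * (theta1 * e2 k)) by ring.
apply: lerD.
  apply: le_trans (_ : _ <= (1 - alpha) * wnorm (w_pi p)
      (fun i => m k i - xb k)) _.
    by apply: wnorm_dominated => // i; rewrite normrZ ger0_norm.
  rewrite ler_wpM2l//; under [X in wnorm _ X]eq_fun do rewrite dev_mx_A.
  exact: (wnorm_mx hH).
apply: le_trans (_ : _ <= alpha * wnorm (w_pi p)
    (fun i => g k i - \sum_j p j ord0 *: g k j)) _.
  by apply: wnorm_dominated => [//| |i]; rewrite ?normrZ ?ger0_norm// ltW.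
rewrite (ler_wpM2l (ltW a0))//.
have [h _] := weighted_mean_bounds hH (g k) wp0 hp1.
apply: le_trans h _; apply: le_trans (g_le k) _.
(* The estimate holds without [c2]; [c2 >= 1] inserts it to match M. *)
by rewrite ler_peMl// mulr_ge0 ?wnorm_ge0.
Qed.

(** Column sums equal to 1 conserve the total of y under mixing, and the increments of the F_i
    telescope. *)
Let yb_invariant k : yb k = \sum_i Fs i (x k i).
Proof.
have [y0 _ yS] := hxy.
elim: k => [|k IH]; first by apply: eq_bigr => i _; rewrite y0.
rewrite /yb; under eq_bigr do rewrite yS.
rewrite sumrB big_split -IH /=.
suff -> : \sum_i \sum_j B i j *: y k j = yb k by rewrite addrAC subrr add0r.
rewrite exchange_big; apply: eq_bigr => j _ /=.
by rewrite -scaler_suml; case: hB => _ ->; rewrite scale1r.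
Qed.

Let sum_norm_le (z : 'I_N -> H) : \sum_i `|z i| <= sqN * wnorm w_one z.
Proof.
rewrite -(ler_pXn2r (ltn0Sn 1)) ?nnegrE ?mulr_ge0 ?sqrtr_ge0 ?sumr_ge0//.
rewrite exprMn sqN2 wnorm_sqr//.
have := weighted_Cauchy_Schwarz (fun=> 1) (fun i => `|z i|) wo0'.
under eq_bigr do rewrite !mul1r.
under [in X in _ <= X * _]eq_bigr do rewrite expr1n mulr1.
by rewrite sumr_const card_ord.
Qed.

Let wnorm_const (c : H) : wnorm w_one (fun _ : 'I_N => c) = sqN * `|c|.
Proof.
rewrite /wnorm; under eq_bigr do rewrite mul1r.
by rewrite sumr_const card_ord -mulr_natl sqrtrM ?ler0n// sqrtr_sqr normr_id.
Qed.

(** The difference is the mean of F_i(x_i) - F_i(xb); Cauchy-Schwarz costs sqrt N, against the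
    factor 1/N. *)
Let tracking_error k :
  `|N%:R^-1 *: yb k - F (xb k)| <= Lbar * (e1 k / c1) / sqN.
Proof.
have sqN0 : 0 < sqN by rewrite (lt_le_trans ltr01).
rewrite /F /average yb_invariant -scalerBr -sumrB normrZ ger0_norm; last first.
  by rewrite invr_ge0 ltW.
rewrite mulrC ler_pdivrMr//.
have -> : Lbar * (e1 k / c1) / sqN * N%:R = Lbar * (e1 k / c1) * sqN.
  by rewrite -sqN2; field; rewrite !gt_eqF.
apply: le_trans (ler_norm_sum _ _ _) _.
apply: le_trans (_ : _ <= \sum_i Lbar * `|x k i - xb k|) _.
  apply: ler_sum => i _; apply: le_trans (hLip _ _ _) _.
  by rewrite ler_wpM2r.
rewrite -mulr_sumr -mulrA ler_wpM2l// mulrC.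
apply: le_trans (sum_norm_le _) _; by rewrite ler_pM2l.
Qed.

(** The increment splits into m - x (giving [theta4]), g ([theta1]), m - xb ([rho1]), and a part [t]
    independent of i: tracking error ([Lbar]) plus fixed-point residual ([e3]). A constant family
    has norm sqrt N times that of its value. *)
Let displacement_le k :
  wnorm w_one (fun i => x k.+1 i - x k i) <=
  c1^-1 * ((alpha * (rho1 + Lbar) + theta4) * e1 k + alpha * theta1 * e2 k
           + 2 * alpha * c1 * sqN * e3 k).
Proof.
have /andP[a0 a1] := halpha.
have e1_ge0 : 0 <= e1 k by exact: wnorm_ge0.
have sqN0 : 0 < sqN by rewrite (lt_le_trans ltr01).
pose t := N%:R^-1 *: yb k - F (xb k) + (F (xb k) - xb k).
have -> : wnorm w_one (fun i => x k.+1 i - x k i) = wnorm w_one (fun i =>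
    (m k i - x k i) + alpha *: (g k i + t - (m k i - xb k))).
  congr (wnorm _ _); apply/funext => i; rewrite xE relaxation_increment.
  by rewrite /t subrKA opprB !addrA subrK.
have m_x : wnorm w_one (fun i => m k i - x k i) <= theta4 * (e1 k / c1).
  under eq_fun do rewrite dev_mx_1.
  by apply: le_trans (wnorm_mx hH _ _ wo0) _; rewrite ler_wpM2l.
have m_xb : wnorm w_one (fun i => m k i - xb k) <= rho1 * (e1 k / c1).
  apply: le_trans (wnorm_one_pi _) _; rewrite mulrA ler_pM2r ?invr_gt0//.
  by under eq_fun do rewrite dev_mx_A; exact: (wnorm_mx hH).
have g1 : wnorm w_one (g k) <= theta1 * e2 k / c1.
  by apply: le_trans (wnorm_one_pi _) _; rewrite ler_pM2r ?invr_gt0.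
have t1 : wnorm w_one (fun _ : 'I_N => t) <= Lbar * (e1 k / c1) + 2 * sqN * e3 k.
  rewrite wnorm_const; apply: le_trans (_ : _ <= sqN *
      (Lbar * (e1 k / c1) / sqN + 2 * e3 k)) _.
    rewrite ler_pM2l//; apply: le_trans (ler_normD _ _) _; apply: lerD.
      exact: tracking_error.
    exact: quasi_nonexpansive_displacement.
  by rewrite le_eqVlt; apply/orP; left; apply/eqP; field; rewrite !gt_eqF.
apply: le_trans (wnormD _ _ wo0') _.
apply: le_trans (_ : _ <= theta4 * (e1 k / c1) + alpha *
    (theta1 * e2 k / c1 + (Lbar * (e1 k / c1) + 2 * sqN * e3 k)
     + rho1 * (e1 k / c1))) _; last first.
  rewrite le_eqVlt; apply/orP; left; apply/eqP.
  by field; rewrite gt_eqF.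
apply: lerD m_x _.
apply: le_trans (_ : _ <= alpha * wnorm w_one
    (fun i => g k i + t - (m k i - xb k))) _.
  by apply: wnorm_dominated => [//| |i]; rewrite ?normrZ ?ger0_norm// ltW.
rewrite (ler_wpM2l (ltW a0))//.
apply: le_trans (wnormB _ _ wo0') _; apply: lerD m_xb.
by apply: le_trans (wnormD _ _ wo0') _; exact: lerD.
Qed.

Let theta2 : R := c2 * Lbar * (sqN + 1) / (c1 * c3).

Lemma tracking_step k :
  e2 k.+1 <= theta2 * (alpha * (rho1 + Lbar) + theta4) * e1 k
    + (rho2 + alpha * theta1 * theta2) * e2 k
    + 2 * alpha * c1 * theta2 * e3 k.
Proof.
have /andP[a0 a1] := halpha.
have [_ _ yS] := hxy.
pose h i := Fs i (x k.+1 i) - Fs i (x k i).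
have -> : e2 k.+1 = wnorm (w_nu v) (fun i =>
    (\sum_j B i j *: y k j - v i ord0 *: yb k)
    + (h i - v i ord0 *: \sum_j h j)).
  congr (wnorm _ _); apply/funext => i; rewrite yS /h sumrB -!yb_invariant.
  by rewrite addrACA -opprD -scalerDr [yb k + _]addrC subrK addrA.
have h_le : wnorm (w_nu v) h <= c2 * Lbar / (c1 * c3) *
    ((alpha * (rho1 + Lbar) + theta4) * e1 k + alpha * theta1 * e2 k
           + 2 * alpha * c1 * sqN * e3 k).
  apply: le_trans (wnorm_nu_pi _) _.
  rewrite ler_pdivrMr//; apply: le_trans (wnorm_pi_one _) _.
  apply: le_trans (_ : _ <=
      c2 * (Lbar * wnorm w_one (fun i => x k.+1 i - x k i))) _.
    rewrite ler_pM2l//; apply: wnorm_dominated => // i.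
    by apply: le_trans (hLip _ _ _) _; rewrite ler_wpM2r.
  apply: le_trans (_ : _ <= c2 * (Lbar * (c1^-1 * ((alpha * (rho1 + Lbar) + theta4)
      * e1 k + alpha * theta1 * e2 k + 2 * alpha * c1 * sqN * e3 k)))) _.
    by rewrite ler_pM2l// ler_wpM2l// displacement_le.
  by rewrite le_eqVlt; apply/orP; left; apply/eqP; field; rewrite !gt_eqF.
apply: le_trans (wnormD _ _ wv0') _.
have d_le : wnorm (w_nu v) (fun i => \sum_j B i j *: y k j - v i ord0 *: yb k)
    <= rho2 * e2 k.
  by under eq_fun do rewrite dev_mx_B; exact: (wnorm_mx hH).
apply: le_trans (lerD d_le (le_trans (wnorm_nu_deviation hH h hv0 hv1) h_le)) _.
pose K := c2 * Lbar / (c1 * c3).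
have K0 : 0 <= K.
  by rewrite divr_ge0 ?mulr_ge0 ?(ltW hc1) ?(ltW hc2) ?(ltW hc3).
have e10 : 0 <= e1 k by exact: wnorm_ge0.
have e20 : 0 <= e2 k by exact: wnorm_ge0.
have e30 : 0 <= e3 k by exact: dist_to_ge0.
have sqN0 : 0 <= sqN by exact: sqrtr_ge0.
(* The derived bound has factor [K] on [e1], [e2] and [K * sqN] on [e3]. The uniform
   [theta2 = K * (sqN + 1)] covers both, and [gap] is the surplus. *)
have gap : 0 <= K * sqN * ((alpha * (rho1 + Lbar) + theta4) * e1 k
    + alpha * theta1 * e2 k) + 2 * alpha * c1 * K * e3 k.
  have a0' := ltW a0; have c10 := ltW hc1.
  have q1 := addr_ge0 (mulr_ge0 a0' (addr_ge0 rho1_ge0 Lbar_ge0)) theta4_ge0.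
  have q2 := mulr_ge0 a0' theta1_ge0.
  apply: addr_ge0.
    exact: mulr_ge0 (mulr_ge0 K0 sqN0)
                    (addr_ge0 (mulr_ge0 q1 e10) (mulr_ge0 q2 e20)).
  exact: mulr_ge0 (mulr_ge0 (mulr_ge0 (mulr_ge0 (ler0n _ 2) a0') c10) K0) e30.
rewrite -subr_ge0; apply: le_trans gap _.
rewrite le_eqVlt; apply/orP; left; apply/eqP; rewrite /K /theta2.
by field; rewrite !gt_eqF.
Qed.

(** The mean follows a Krasnoselskii-Mann iteration of F, with an error made of the mean of [g] and
    the tracking error. *)
Let xb_relaxed k :
  `|xb k.+1 - ((1 - alpha) *: xb k + alpha *: F (xb k))| <=
  alpha * (theta1 * e2 k + Lbar * (e1 k / c1)).
Proof.
have /andP[a0 a1] := halpha.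
rewrite xbE opprD addrACA subrr add0r -scalerBr -addrA normrZ gtr0_norm//.
rewrite ler_pM2l//; apply: le_trans (ler_normD _ _) _; apply: lerD.
  have [_ gb] := weighted_mean_bounds hH (g k) wp0 hp1.
  exact: le_trans gb (g_le k).
apply: le_trans (tracking_error k) _.
rewrite ler_pdivrMr ?(lt_le_trans ltr01)// ler_peMr// mulr_ge0//.
by rewrite divr_ge0 ?wnorm_ge0// ltW.
Qed.

Context (delta : R) (hdelta : 0 < delta) (hdelta' : alpha < 1 - delta).

(** The distance is 1-Lipschitz, so the error of [xb_relaxed] adds to the exact averaged step. The
    coefficient of [e2] is enlarged by sqrt N / c1 >= 1. *)
Lemma fixed_point_step k :
  e3 k.+1 <= alpha * Lbar / c1 * e1 k + alpha * sqN * theta1 / c1 * e2 k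
    + (1 - delta * alpha / (4 * kappa ^+ 2)) * e3 k.
Proof.
have /andP[a0 a1] := halpha.
apply: le_trans (dist_to_lipschitz _
  ((1 - alpha) *: xb k + alpha *: F (xb k)) hFix) _.
rewrite addrC; apply: lerD; last first.
  have a_range : 0 < alpha < 1 - delta by rewrite a0.
  by case: (averaged_dist_to hH hFix hqne hkappa (hreg (xb k)) hdelta a_range).
apply: le_trans (xb_relaxed k) _.
have : theta1 * e2 k <= sqN / c1 * (theta1 * e2 k).
  apply: ler_peMl; first exact: mulr_ge0 theta1_ge0 (wnorm_ge0 _ _).
  by rewrite ler_pdivlMr// mul1r (le_trans c1_le1).
move=> /(ler_wpM2l (ltW a0)) h; rewrite mulrDr addrC; apply: lerD.
  by rewrite le_eqVlt; apply/orP; left; apply/eqP; field; rewrite gt_eqF.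
apply: le_trans h _.
by rewrite le_eqVlt; apply/orP; left; apply/eqP; field; rewrite gt_eqF.
Qed.

Lemma fixed_point_coef_ge0 k :
  0 <= (1 - delta * alpha / (4 * kappa ^+ 2)) * e3 k.
Proof.
have /andP[a0 a1] := halpha.
have a_range : 0 < alpha < 1 - delta by rewrite a0.
by case: (averaged_dist_to hH hFix hqne hkappa (hreg (xb k)) hdelta a_range).
Qed.

(** An increment of [xb] is the relaxation error plus alpha times the residual F xb - xb, both of
    order r^k, so [xb] converges geometrically; [e1] then brings every x_i along. *)
Lemma linear_convergence_of_errors (C r : R) : 0 < C -> 0 < r < 1 ->
  (forall k, [/\ e1 k <= C * r ^+ k, e2 k <= C * r ^+ k & e3 k <= C * r ^+ k]) ->
  linear_common_convergence (Fix F) x.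
Proof.
move=> C0 r01 he; have /andP[a0 a1] := halpha.
have /andP[r0 r1] := r01.
have rk k : 0 < r ^+ k by rewrite exprn_gt0.
have displ k : `|F (xb k) - xb k| <= 2 * (C * r ^+ k).
  apply: le_trans (quasi_nonexpansive_displacement _ hFix hqne) _.
  by rewrite ler_pM2l//; case: (he k).
have incr k : `|xb k.+1 - xb k| <=
    alpha * (theta1 * C + Lbar * (C / c1) + 2 * C) * r ^+ k.
  have -> : xb k.+1 - xb k =
      xb k.+1 - ((1 - alpha) *: xb k + alpha *: F (xb k))
      + alpha *: (F (xb k) - xb k).
    rewrite -[X in _ = _ + X]add0r -(subrr (xb k)) -relaxation_increment.
    by rewrite addrA subrK.
  apply: le_trans (ler_normD _ _) _.
  apply: le_trans (_ : _ <= alpha * (theta1 * (C * r ^+ k)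
     + Lbar * (C * r ^+ k / c1)) + alpha * (2 * (C * r ^+ k))) _; last first.
    by rewrite le_eqVlt; apply/orP; left; apply/eqP; field; rewrite gt_eqF.
  have [h1 h2 h3] := he k; apply: lerD.
    apply: le_trans (xb_relaxed k) _; rewrite ler_pM2l//.
    apply: lerD; rewrite ler_wpM2l//.
    by rewrite ler_pM2r ?invr_gt0.
  by rewrite normrZ gtr0_norm// ler_pM2l.
have [l hl] := geometric_increments_cvg r01 incr.
set C' := _ / (1 - r) in hl.
have C'0 : 0 <= C' by have := le_trans (normr_ge0 _) (hl 0%N); rewrite expr0 mulr1.
have F_lip z z' : `|F z - F z'| <= Lbar * `|z - z'|.
  rewrite /F /average -scalerBr -sumrB normrZ gtr0_norm ?invr_gt0//.
  rewrite mulrC ler_pdivrMr//; apply: le_trans (ler_norm_sum _ _ _) _.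
  apply: le_trans (_ : _ <= \sum_(i < N) Lbar * `|z - z'|) _.
    apply: ler_sum => i _; apply: le_trans (hLip _ _ _) _.
    by rewrite ler_wpM2r.
  by rewrite sumr_const card_ord mulr_natr.
exists l; split.
  apply/eqP; rewrite -subr_eq0 -normr_eq0; apply/eqP.
  (* The summands bound |F l - F xb|, |F xb - xb| and |xb - l| in this order. *)
  apply: (@geometric_vanish R _ (Lbar * C' + 2 * C + C') r) => // k.
  have -> : F l - l = (F l - F (xb k)) + (F (xb k) - xb k) + (xb k - l).
    by rewrite !subrKA.
  apply: le_trans (ler_normD _ _) _; rewrite mulrDl; apply: lerD; last exact: hl.
  apply: le_trans (ler_normD _ _) _; rewrite mulrDl; apply: lerD.
    apply: le_trans (F_lip _ _) _; rewrite distrC -mulrA ler_wpM2l//.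
  by rewrite -mulrA.
exists (C / c1 + C'), r; split=> //; first by rewrite ltr_wpDr// divr_gt0.
move=> i k; rewrite -(subrK (xb k) (x k i)) -addrA mulrDl.
apply: le_trans (ler_normD _ _) _; apply: lerD; last exact: hl.
have := norm_coord_le_wnorm (fun i => x k i - xb k) i wo0.
rewrite sqrtr1 invr1 mul1r => /le_trans; apply.
apply: le_trans (wnorm_one_pi _) _; rewrite mulrAC ler_pM2r ?invr_gt0//.
by case: (he k).
Qed.

End StepInequalities.

(** * The comparison system at the given stepsize *)

Theorem theorem1 (R : realType) (H : completeNormedModType R)
    (ip : {dot H for idfun}) (hH : norm_of_dot ip)
    (N : nat) (hN : (0 < N)%N) (Fs : 'I_N -> H -> H)
    (e : rel 'I_N) (A B : 'M[R]_N)
    (he : simple_digraph e) (hconn : strongly_connected e)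
    (hA : row_stochastic A) (hB : col_stochastic B)
    (hAe : consistent e A) (hBe : consistent e B)
    (hAd : forall i, 0 < A i i) (hBd : forall i, 0 < B i i)
    (L : 'I_N -> R) (hL : forall i, 0 < L i)
    (hLip : forall i x y, `|Fs i x - Fs i y| <= L i * `|x - y|)
    (hqne : quasi_nonexpansive (average Fs))
    (hFix : Fix (average Fs) !=set0)
    (kappa : R) (hkappa : 0 < kappa)
    (hreg : forall x, dist_to (Fix (average Fs)) x
                      <= kappa * `|average Fs x - x|)
    (p v : 'cV[R]_N) (hp1 : sums_to_one p) (hpA : p^T *m A = p^T)
    (hv1 : sums_to_one v) (hBv : B *m v = v)
    (c1 c2 c3 c4 : R) (hc1 : 0 < c1) (hc2 : 0 < c2) (hc3 : 0 < c3)
    (hc4 : 0 < c4) (hc : norm_constants H p v c1 c2 c3 c4)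
    (delta : R) (hdelta : 0 < delta < 1)
    (alphac : R)
    (halphac : smallest_positive_root
       (fun a => \det (1%:M - Mstep A B p v c1 c2 c3 c4 L kappa delta a))
       alphac)
    (alpha : R) (halpha : 0 < alpha < Num.min (1 - delta) alphac)
    (x y : nat -> 'I_N -> H) (hxy : DOT_sequence A B v Fs alpha x y) :
  linear_common_convergence (Fix (average Fs)) x.
Proof.
have Airr := irreducible_consistent he hconn hAe.
have Birr := irreducible_consistent he hconn hBe.
have p0 := stationary_pos hA Airr hp1 hpA.
(* Transposition makes [v] a left stationary vector, so positivity of [v] comes from the
   row-stochastic case. *)
have hBt : row_stochastic B^T.
  case: hB => B0 B1; split=> [i j|i]; first by rewrite mxE.
  by under eq_bigr do rewrite mxE.
have vB : v^T *m B^T = v^T by rewrite -trmx_mul hBv.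
have v0 := stationary_pos hBt (irreducible_trmx Birr) hv1 vB.
have [q1 hq1 hq1u] := stochastic_contraction hA hAd Airr p0 hp1 hpA.
have [q2 hq2 hq2u] := col_stochastic_contraction hB hBd Birr v0 hv1 hBv.
have Ainf := mx_infty_row_stochastic hA p0 hp1 hpA hq1 hq1u.
have Binf := mx_infty_col_stochastic hB v0 hv1 hBv hq2 hq2u.
have wp0 i : 0 < w_pi p i by exact: p0.
have wv0 i : 0 < w_nu v i by rewrite invr_gt0.
have wo0 i : 0 < @w_one R N i by exact: ltr01.
have /andP[delta0 delta1] := hdelta.
have /andP[alpha0] := halpha; rewrite lt_min => /andP[alpha_delta alpha_c].
have alpha1 : 0 < alpha < 1 by rewrite alpha0 (lt_trans alpha_delta)// gtrBl.
have Lbar0 : 0 <= \big[Num.max/0]_(i < N) L i.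
  exact: le_trans (ltW (hL (Ordinal hN))) (le_bigmax _ _ _).
pose rho1 := opnorm (w_pi p) (A - mx_infty A).
pose rho2 := opnorm (w_nu v) (B - mx_infty B).
pose theta1 := c4 * opnorm w_one (invmx (diag_mx v^T)) / N%:R.
pose theta2 := c2 * \big[Num.max/0]_(i < N) L i * (Num.sqrt N%:R + 1) / (c1 * c3).
pose theta3 := rho1 + \big[Num.max/0]_(i < N) L i.
pose theta4 := opnorm w_one (A - 1%:M).
pose s := delta / (4 * kappa ^+ 2).
have rho1_ge0 : 0 <= rho1 by exact: opnorm_ge0.
have rho2_ge0 : 0 <= rho2 by exact: opnorm_ge0.
have theta4_ge0 : 0 <= theta4 by exact: opnorm_ge0.
have theta1_ge0 : 0 <= theta1.
  exact: divr_ge0 (mulr_ge0 (ltW hc4) (opnorm_ge0 _ wo0)) (ler0n _ _).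
have theta2_ge0 : 0 <= theta2.
  apply: divr_ge0 (mulr_ge0 (ltW hc1) (ltW hc3)).
  exact: mulr_ge0 (mulr_ge0 (ltW hc2) Lbar0) (addr_ge0 (sqrtr_ge0 _) ler01).
have theta3_ge0 : 0 <= theta3 by exact: addr_ge0 rho1_ge0 Lbar0.
have s0 : 0 < s by rewrite divr_gt0// mulr_gt0// exprn_gt0.
have sE a : delta * a / (4 * kappa ^+ 2) = s * a by rewrite /s mulrAC.
have rho1_lt1 : rho1 < 1.
  have /andP[q1_ge0 q1_lt1] := hq1.
  by apply: le_lt_trans q1_lt1; rewrite /rho1 Ainf; exact: opnorm_le.
have rho2_lt1 : rho2 < 1.
  have /andP[q2_ge0 q2_lt1] := hq2.
  by apply: le_lt_trans q2_lt1; rewrite /rho2 Binf; exact: opnorm_le.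
(* Every power of [b] is exposed, in the shape from which [step_det_pos] divides one factor out. *)
have detE b : \det (1%:M - Mstep A B p v c1 c2 c3 c4 L kappa delta b) =
    (1 - (1 - b) * rho1) * ((1 - (rho2 + b * (theta1 * theta2)))
        * (1 - (1 - s * b)) - b * (2 * c1 * theta2)
            * (b * (Num.sqrt N%:R * theta1 / c1)))
    - b * (c2 * theta1) * ((theta2 * theta4 + b * (theta2 * theta3))
        * (1 - (1 - s * b)) + b * (2 * c1 * theta2)
            * (b * ((\big[Num.max/0]_(i < N) L i) / c1))).
  pose rows : seq (seq R) :=
    [:: [:: (1 - b) * rho1; b * c2 * theta1; 0];
        [:: theta2 * (b * theta3 + theta4); rho2 + b * theta1 * theta2;
            2 * b * c1 * theta2];
        [:: b * (\big[Num.max/0]_(i < N) L i) / c1;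
            b * Num.sqrt N%:R * theta1 / c1; 1 - delta * b / (4 * kappa ^+ 2)]].
  have -> : 1%:M - Mstep A B p v c1 c2 c3 c4 L kappa delta b =
      \matrix_(i < 3, j < 3) ((i == j :> nat)%:R - nth 0 (nth [::] rows i) j).
    by apply/matrixP => i j; rewrite !mxE.
  rewrite (det3 (fun i j => (i == j)%:R - nth 0 (nth [::] rows i) j)) /= sE.
  ring.
have [_ _ alphac_min] := halphac.
have det_pos : 0 < \det (1%:M - Mstep A B p v c1 c2 c3 c4 L kappa delta alpha).
  rewrite detE; apply: (@step_det_pos R rho1 rho2 s _ _ _ _ _ _ _ alphac) => //.
    by move=> b b0 fb; apply: alphac_min => //; rewrite detE.
  by rewrite alpha0.
have a0 := ltW alpha0.
have a1 : 0 <= 1 - alpha.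
  by case/andP: alpha1 => _ /ltW; rewrite subr_ge0.
have m11 : 0 <= (1 - alpha) * rho1 by exact: mulr_ge0 a1 rho1_ge0.
have m12 : 0 <= alpha * c2 * theta1.
  exact: mulr_ge0 (mulr_ge0 a0 (ltW hc2)) theta1_ge0.
have m21 : 0 <= theta2 * (alpha * theta3 + theta4).
  exact: mulr_ge0 theta2_ge0 (addr_ge0 (mulr_ge0 a0 theta3_ge0) theta4_ge0).
have m22 : 0 <= rho2 + alpha * theta1 * theta2.
  exact: addr_ge0 rho2_ge0 (mulr_ge0 (mulr_ge0 a0 theta1_ge0) theta2_ge0).
have m23 : 0 <= 2 * alpha * c1 * theta2.
  exact: mulr_ge0 (mulr_ge0 (mulr_ge0 (ler0n _ 2) a0) (ltW hc1)) theta2_ge0.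
have m31 : 0 <= alpha * (\big[Num.max/0]_(i < N) L i) / c1.
  exact: divr_ge0 (mulr_ge0 a0 Lbar0) (ltW hc1).
have m32 : 0 <= alpha * Num.sqrt N%:R * theta1 / c1.
  exact: divr_ge0 (mulr_ge0 (mulr_ge0 a0 (sqrtr_ge0 _)) theta1_ge0) (ltW hc1).
have m11_lt1 : (1 - alpha) * rho1 < 1.
  apply: le_lt_trans rho1_lt1; rewrite -[leRHS]mul1r ler_wpM2r//.
  by rewrite gerBl.
have m33_lt1 : 1 - delta * alpha / (4 * kappa ^+ 2) < 1.
  by rewrite sE gtrBl mulr_gt0.
have det_pos' : 0 < (1 - (1 - alpha) * rho1) *
    ((1 - (rho2 + alpha * theta1 * theta2))
       * (1 - (1 - delta * alpha / (4 * kappa ^+ 2)))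
     - 2 * alpha * c1 * theta2 * (alpha * Num.sqrt N%:R * theta1 / c1))
    - alpha * c2 * theta1 * (theta2 * (alpha * theta3 + theta4)
       * (1 - (1 - delta * alpha / (4 * kappa ^+ 2)))
     + 2 * alpha * c1 * theta2 * (alpha * (\big[Num.max/0]_(i < N) L i) / c1)).
  rewrite [X in _ < X](_ : _ =
    \det (1%:M - Mstep A B p v c1 c2 c3 c4 L kappa delta alpha))//.
  by rewrite detE sE; ring.
have [w1 [w2 [w3 [r [[w1_gt0 w2_gt0 w3_gt0] r01 e1 e2 e3]]]]] :=
  perron_vector3 m12 m21 m23 m31 m32 m11_lt1 m33_lt1 det_pos'.
have r0 : 0 < r by case/andP: r01.
have [|||||||C C0 hC] := geometric_decay3 m11 m12 m21 m22 m23 m31 m32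
  w1_gt0 w2_gt0 w3_gt0 r0 e1 e2 e3
  (z1 := fun k => wnorm (w_pi p) (fun i => x k i - \sum_i p i ord0 *: x k i))
  (z2 := fun k => wnorm (w_nu v) (fun i => y k i - v i ord0 *: \sum_i y k i))
  (z3 := fun k => dist_to (Fix (average Fs)) (\sum_i p i ord0 *: x k i)).
- by move=> k; exact: wnorm_ge0.
- by move=> k; exact: wnorm_ge0.
- by move=> k; exact: dist_to_ge0.
- exact: (fixed_point_coef_ge0 hH hqne hFix hkappa hreg p alpha1 x delta0
    alpha_delta).
- exact: (consensus_step hH hN hA p0 v0 hp1 hpA Ainf hc4 hc alpha1 hxy).
- exact: (tracking_step hH hN hL hLip hqne hFix hA hB p0 v0 hp1 hv1 hBv
    Ainf Binf hc1 hc2 hc3 hc4 hc alpha1 hxy).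
- exact: (fixed_point_step hH hN hL hLip hqne hFix hkappa hreg hB p0 v0 hp1 hpA
    hc1 hc4 hc alpha1 hxy delta0 alpha_delta).
exact: (linear_convergence_of_errors hH hN hL hLip hqne hFix hB p0 v0 hp1 hpA
  hc1 hc4 hc alpha1 hxy C0 r01 hC).
Qed.
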